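(* Let $W$ be a $2$-parameter persistence module over $k=\mathbb{Z}_2$. If $P$ is a semi-minimal presentation of $W$ (given as a graded matrix representing a homomorphism $F^1\to F^0$ of finitely generated free persistence modules), and $Q$ is the graded matrix obtained from $P$ by applying multi-chunk (to the short chain complex $F^1\xrightarrow{P}F^0\to 0$), then $Q$ is a minimal presentation of $W$.
   Context: **Persistence modules.** Let $k=\mathbb{Z}_2$ and let $\mathbb{Z}^2$ carry the product partial order. A ($2$-parameter) persistence module is a functor $M:\mathbb{Z}^2\to \mathrm{Vec}_k$; homomorphisms are natural transformations; kernels, cokernels and direct sums are pointwise. Elements $v\in M_{\mathbf z}$ are called homogeneous of grade $\mathrm{gr}(v)=\mathbf z$. For $\mathbf u\in\mathbb{Z}^2$, $E^{\mathbf u}$ is the module with $E^{\mathbf u}_{\mathbf z}=k$ if $\mathbf u\le \mathbf z$ and $0$ otherwise, with identity maps between nonzero spaces. A module is free if it is isomorphic to a direct sum of modules $E^{\mathbf u}$; a basis is a minimal set of homogeneous generators. **Presentations.** A presentation of $M$ is a homomorphism $p:F^1\to F^0$ between free persistence modules with $\operatorname{Coker}(p)\cong M$. With $q:F^0\to\operatorname{Coker}(p)$ the canonical map, $p$ is minimal if (1) $q$ maps a basis of $F^0$ bijectively to a minimal homogeneous set of generators of $\operatorname{Coker}(p)$ and (2) $p$ maps a basis of $F^1$ bijectively to a minimal homogeneous set of generators of $\operatorname{Ker}(q)$. A presentation is semi-minimal if it can be obtained (up to isomorphism) from a minimal presentation by taking the direct sum with maps of the form $\mathrm{id}_H:H\to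 H$ with $H$ free. **Graded matrices.** A homomorphism between finitely generated free modules with ordered bases is represented by a graded matrix: columns correspond to the basis of the source, rows to the basis of the target, annotated with the grades of the basis elements. Rows and columns are in co-lexicographic order with respect to grades (equal grades ordered arbitrarily). The index of a row or column is its position. The pivot of a nonzero column is its largest row index with nonzero entry; if the grade of the pivot equals the grade of the column, it is called the local pivot of the column. **multi-chunk applied to $F^1\xrightarrow{P}F^0\to0$.** *Phase I.* Traverse the columns of $P$ in increasing index. As long as the current column $c$ has a local pivot and there is a column $c'$ of smaller index with the same local pivot, perform $c\leftarrow c+c'$. If at the end $c$ has no local pivot, label $c$ global; otherwise label $c$ local negative and the row of its local pivot local positive. Rows not labeled local positive are global. *Phase II.* For each global column $c$: while $c$ has a nonzero entry in a local positive row, let $c'$ be the local positive row of maximal index with nonzero entry in $c$, let $c''$ be the unique local negative column with local pivot $c'$, and perform $c\leftarrow c+c''$. *Phase III.* Remove all local negative columns and all local positive rows. The resulting graded matrix is $Q$. *)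

(* Defs.v *)
From HB Require Import structures.
From mathcomp Require Import all_boot all_order all_algebra.
From mathcomp Require Import boolp classical_sets functions cardinality.

Set Implicit Arguments.
Unset Strict Implicit.
Unset Printing Implicit Defensive.

Import Order.TTheory GRing.Theory.
Local Open Scope ring_scope.

Definition grade : Type := (int *p int)%type.
HB.instance Definition _ := Order.POrder.on grade.

Record pmod := PMod {
  pspace :> grade -> lmodType 'F_2;
  pmap : forall a b : grade, (a <= b)%O -> {linear pspace a -> pspace b};
  pmap_id : forall (a : grade) (x : pspace a), pmap (lexx a) x = x;
  pmap_comp : forall (a b c : grade) (ab : (a <= b)%O) (bc : (b <= c)%O)
      (x : pspace a), pmap (le_trans ab bc) x = pmap bc (pmap ab x) }.

Arguments pmap M {a b} : rename.

Record phom (M N : pmod) := PHom {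
  pfun :> forall z : grade, {linear M z -> N z};
  pnat : forall (a b : grade) (ab : (a <= b)%O) (x : M a),
    pfun b (pmap M ab x) = pmap N ab (pfun a x) }.

Definition is_iso (M N : pmod) (f : phom M N) : Prop :=
  exists g : phom N M, forall z, cancel (f z) (g z) /\ cancel (g z) (f z).

Definition isomorphic (M N : pmod) : Prop := exists f : phom M N, is_iso f.

Definition arrow_iso (M N M' N' : pmod) (f : phom M N) (f' : phom M' N') :
    Prop :=
  exists (a : phom M M') (b : phom N N'),
    [/\ is_iso a, is_iso b & forall z x, b z (f z x) = f' z (a z x)].

Section IdHom.
Variable M : pmod.
Fact id_hom_nat (a b : grade) (ab : (a <= b)%O) (x : M a) :
  (idfun : {linear M b -> M b}) (pmap M ab x) =
  pmap M ab ((idfun : {linear M a -> M a}) x).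
Proof. by []. Qed.
Definition id_hom : phom M M := @PHom M M (fun z => idfun) id_hom_nat.
End IdHom.

Section LinearKernel.
Variables (V V' : lmodType 'F_2) (f : {linear V -> V'}).
Definition ker_pred : {pred V} := fun x => f x == 0.
Fact ker_pred_closed : submod_closed ker_pred.
Proof.
split=> [|c x y]; rewrite /in_mem /= /ker_pred ?linear0 //.
by move=> /eqP fx /eqP fy; rewrite linearP fx fy scaler0 addr0.
Qed.
HB.instance Definition _ :=
  GRing.isSubmodClosed.Build 'F_2 V ker_pred ker_pred_closed.

Record lker : Type := LKer { lker_val :> V; _ : lker_val \in ker_pred }.
HB.instance Definition _ := [isSub for lker_val].
HB.instance Definition _ := [Choice of lker by <:].
HB.instance Definition _ := [SubChoice_isSubLmodule of lker by <:].
End LinearKernel.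

Section Kernel.
Variables (M N : pmod) (f : phom M N).
Implicit Types a b c z : grade.

Fact ker_map_proof a b (ab : (a <= b)%O) (x : lker (f a)) :
  pmap M ab (val x) \in ker_pred (f b).
Proof.
by rewrite /in_mem /= /ker_pred pnat (eqP (valP x)) linear0.
Qed.
Definition ker_map a b (ab : (a <= b)%O) (x : lker (f a)) : lker (f b) :=
  LKer (ker_map_proof ab x).
Fact ker_map_linear a b (ab : (a <= b)%O) : linear (ker_map ab).
Proof. by move=> c x y; apply: val_inj; rewrite /= !linearP. Qed.
HB.instance Definition _ a b (ab : (a <= b)%O) :=
  GRing.isLinear.Build 'F_2 (lker (f a)) (lker (f b)) _ (ker_map ab)
    (ker_map_linear ab).

Fact ker_map_id a (x : lker (f a)) : ker_map (lexx a) x = x.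
Proof. by apply: val_inj; rewrite /= pmap_id. Qed.
Fact ker_map_comp a b c (ab : (a <= b)%O) (bc : (b <= c)%O) (x : lker (f a)) :
  ker_map (le_trans ab bc) x = ker_map bc (ker_map ab x).
Proof. by apply: val_inj; rewrite /= pmap_comp. Qed.

Definition pker : pmod :=
  @PMod (fun z => lker (f z)) (fun a b ab => ker_map ab) ker_map_id ker_map_comp.

Fact ker_incl_nat a b (ab : (a <= b)%O) (x : pker a) :
  (val : {linear lker (f b) -> M b}) (pmap pker ab x) =
  pmap M ab ((val : {linear lker (f a) -> M a}) x).
Proof. by []. Qed.
Definition ker_incl : phom pker M := @PHom pker M (fun z => val) ker_incl_nat.
End Kernel.

Section LinearCokernel.
Variables (V V' : lmodType 'F_2) (f : {linear V -> V'}).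
Local Open Scope quotient_scope.

Definition im_pred : {pred V'} := fun y => `[< exists x, f x = y >].
Fact im_pred_closed : submod_closed im_pred.
Proof.
split=> [|c x y]; rewrite /in_mem /= /im_pred.
  by apply/asboolP; exists 0; rewrite linear0.
move=> /asboolP[x' <-] /asboolP[y' <-]; apply/asboolP.
by exists (c *: x' + y'); rewrite linearP.
Qed.
HB.instance Definition _ :=
  GRing.isSubmodClosed.Build 'F_2 V' im_pred im_pred_closed.

Definition lcoker : Type := @Quotient.quot V' im_pred.
HB.instance Definition _ := GRing.Zmodule.on lcoker.

Definition lcoker_pi (y : V') : lcoker := \pi_(@Quotient.quot V' im_pred) y.
Definition lcoker_repr (y : lcoker) : V' := repr (y : @Quotient.quot V' im_pred).

Lemma lcoker_reprK : cancel lcoker_repr lcoker_pi.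
Proof. by move=> y; rewrite /lcoker_pi reprK. Qed.

Lemma lcoker_piP (x y : V') :
  lcoker_pi x = lcoker_pi y <-> exists t, f t = x - y.
Proof.
split=> [/eqP|[t ft]].
  by rewrite -Quotient.idealrBE => /asboolP.
by apply/eqP; rewrite -Quotient.idealrBE; apply/asboolP; exists t.
Qed.

Lemma lcoker_piD (x y : V') : lcoker_pi (x + y) = lcoker_pi x + lcoker_pi y.
Proof. by rewrite /lcoker_pi piE. Qed.

Definition lcoker_scale (c : 'F_2) (y : lcoker) : lcoker :=
  lcoker_pi (c *: lcoker_repr y).

Lemma lcoker_piZ c (y : V') : lcoker_scale c (lcoker_pi y) = lcoker_pi (c *: y).
Proof.
apply/lcoker_piP; have /lcoker_piP[t ft] := lcoker_reprK (lcoker_pi y).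
by exists (c *: t); rewrite linearZ ft; apply: scalerBr.
Qed.

Fact lcoker_scaleA a b y :
  lcoker_scale a (lcoker_scale b y) = lcoker_scale (a * b) y.
Proof. by rewrite -(lcoker_reprK y) !lcoker_piZ scalerA. Qed.
Fact lcoker_scale1 : left_id 1 lcoker_scale.
Proof. by move=> y; rewrite -(lcoker_reprK y) lcoker_piZ scale1r. Qed.
Fact lcoker_scaleDr : right_distributive lcoker_scale +%R.
Proof.
move=> c x y; rewrite -(lcoker_reprK x) -(lcoker_reprK y).
by rewrite -lcoker_piD !lcoker_piZ scalerDr lcoker_piD.
Qed.
Fact lcoker_scaleDl y : {morph lcoker_scale^~ y : a b / a + b}.
Proof.
by move=> a b; rewrite -(lcoker_reprK y) !lcoker_piZ scalerDl lcoker_piD.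
Qed.
HB.instance Definition _ := GRing.Zmodule_isLmodule.Build 'F_2 lcoker
  lcoker_scaleA lcoker_scale1 lcoker_scaleDr lcoker_scaleDl.

Fact lcoker_pi_linear : linear lcoker_pi.
Proof. by move=> c x y; rewrite lcoker_piD -lcoker_piZ. Qed.
HB.instance Definition _ :=
  GRing.isLinear.Build 'F_2 V' lcoker _ lcoker_pi lcoker_pi_linear.
End LinearCokernel.

Section Cokernel.
Variables (M N : pmod) (f : phom M N).
Implicit Types a b c z : grade.

Definition coker_map a b (ab : (a <= b)%O) (y : lcoker (f a)) : lcoker (f b) :=
  lcoker_pi (f b) (pmap N ab (lcoker_repr y)).

Lemma coker_map_pi a b (ab : (a <= b)%O) (y : N a) :
  coker_map ab (lcoker_pi (f a) y) = lcoker_pi (f b) (pmap N ab y).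
Proof.
apply/lcoker_piP.
have /lcoker_piP[t ft] := lcoker_reprK (lcoker_pi (f a) y).
by exists (pmap M ab t); rewrite pnat ft linearB.
Qed.

Fact coker_map_linear a b (ab : (a <= b)%O) : linear (coker_map ab).
Proof.
move=> c x y; rewrite -(lcoker_reprK x) -(lcoker_reprK y).
by rewrite -linearP !coker_map_pi !linearP.
Qed.
HB.instance Definition _ a b (ab : (a <= b)%O) :=
  GRing.isLinear.Build 'F_2 (lcoker (f a)) (lcoker (f b)) _ (coker_map ab)
    (coker_map_linear ab).

Fact coker_map_id a (x : lcoker (f a)) : coker_map (lexx a) x = x.
Proof. by rewrite -(lcoker_reprK x) coker_map_pi pmap_id. Qed.
Fact coker_map_comp a b c (ab : (a <= b)%O) (bc : (b <= c)%O)
    (x : lcoker (f a)) :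
  coker_map (le_trans ab bc) x = coker_map bc (coker_map ab x).
Proof. by rewrite -(lcoker_reprK x) !coker_map_pi pmap_comp. Qed.

Definition pcoker : pmod :=
  @PMod (fun z => lcoker (f z)) (fun a b ab => coker_map ab)
    coker_map_id coker_map_comp.

Fact coker_proj_nat a b (ab : (a <= b)%O) (y : N a) :
  (lcoker_pi (f b) : {linear N b -> pcoker b}) (pmap N ab y) =
  pmap pcoker ab ((lcoker_pi (f a) : {linear N a -> pcoker a}) y).
Proof. by rewrite /= coker_map_pi. Qed.
Definition coker_proj : phom N pcoker :=
  @PHom N pcoker (fun z => lcoker_pi (f z)) coker_proj_nat.
End Cokernel.

Section BinarySum.
Variables M N : pmod.
Implicit Types a b c z : grade.

Definition sum2_map a b (ab : (a <= b)%O) (x : M a * N a) : M b * N b :=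
  (pmap M ab x.1, pmap N ab x.2).
Fact sum2_map_linear a b (ab : (a <= b)%O) : linear (sum2_map ab).
Proof. by move=> c x y; rewrite /sum2_map /= !linearP. Qed.
HB.instance Definition _ a b (ab : (a <= b)%O) :=
  GRing.isLinear.Build 'F_2 (M a * N a)%type (M b * N b)%type _ (sum2_map ab)
    (sum2_map_linear ab).
Fact sum2_map_id a (x : M a * N a) : sum2_map (lexx a) x = x.
Proof. by case: x => x y; rewrite /sum2_map /= !pmap_id. Qed.
Fact sum2_map_comp a b c (ab : (a <= b)%O) (bc : (b <= c)%O) (x : M a * N a) :
  sum2_map (le_trans ab bc) x = sum2_map bc (sum2_map ab x).
Proof. by case: x => x y; rewrite /sum2_map /= !pmap_comp. Qed.
Definition psum2 : pmod :=
  @PMod (fun z => (M z * N z)%type) (fun a b ab => sum2_map ab)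
    sum2_map_id sum2_map_comp.
End BinarySum.

Section BinarySumHom.
Variables (M N M' N' : pmod) (f : phom M M') (g : phom N N').
Implicit Types a b c z : grade.

Definition sum2_fun z (x : M z * N z) : M' z * N' z := (f z x.1, g z x.2).
Fact sum2_fun_linear z : linear (@sum2_fun z).
Proof. by move=> c x y; rewrite /sum2_fun /= !linearP. Qed.
HB.instance Definition _ z :=
  GRing.isLinear.Build 'F_2 (M z * N z)%type (M' z * N' z)%type _ (@sum2_fun z)
    (@sum2_fun_linear z).
Fact sum2_fun_nat a b (ab : (a <= b)%O) (x : psum2 M N a) :
  (@sum2_fun b : {linear psum2 M N b -> psum2 M' N' b}) (pmap (psum2 M N) ab x) =
  pmap (psum2 M' N') ab
    ((@sum2_fun a : {linear psum2 M N a -> psum2 M' N' a}) x).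
Proof. by case: x => x y; rewrite /= /sum2_fun /sum2_map /= !pnat. Qed.
Definition hom_sum2 : phom (psum2 M N) (psum2 M' N') :=
  @PHom (psum2 M N) (psum2 M' N') (fun z => @sum2_fun z) sum2_fun_nat.
End BinarySumHom.

Section LinearSum.
Variables (I : Type) (V : I -> lmodType 'F_2).
Local Open Scope classical_set_scope.

Definition lprod : Type := forall i, V i.
HB.instance Definition _ := Choice.on lprod.
Definition lprod_zero : lprod := fun i => 0.
Definition lprod_opp (f : lprod) : lprod := fun i => - f i.
Definition lprod_add (f g : lprod) : lprod := fun i => f i + g i.
Definition lprod_scale (c : 'F_2) (f : lprod) : lprod := fun i => c *: f i.
Fact lprod_addA : associative lprod_add.
Proof. by move=> f g h; apply: functional_extensionality_dep => i; apply: addrA. Qed.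
Fact lprod_addC : commutative lprod_add.
Proof. by move=> f g; apply: functional_extensionality_dep => i; apply: addrC. Qed.
Fact lprod_add0 : left_id lprod_zero lprod_add.
Proof. by move=> f; apply: functional_extensionality_dep => i; apply: add0r. Qed.
Fact lprod_addN : left_inverse lprod_zero lprod_opp lprod_add.
Proof. by move=> f; apply: functional_extensionality_dep => i; apply: addNr. Qed.
HB.instance Definition _ :=
  GRing.isZmodule.Build lprod lprod_addA lprod_addC lprod_add0 lprod_addN.
Fact lprod_scaleA a b f :
  lprod_scale a (lprod_scale b f) = lprod_scale (a * b) f.
Proof. by apply: functional_extensionality_dep => i; apply: scalerA. Qed.
Fact lprod_scale1 : left_id 1 lprod_scale.
Proof. by move=> f; apply: functional_extensionality_dep => i; apply: scale1r. Qed.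
Fact lprod_scaleDr : right_distributive lprod_scale +%R.
Proof. by move=> c f g; apply: functional_extensionality_dep => i; apply: scalerDr. Qed.
Fact lprod_scaleDl f : {morph lprod_scale^~ f : a b / a + b}.
Proof. by move=> a b; apply: functional_extensionality_dep => i; apply: scalerDl. Qed.
HB.instance Definition _ := GRing.Zmodule_isLmodule.Build 'F_2 lprod
  lprod_scaleA lprod_scale1 lprod_scaleDr lprod_scaleDl.

Definition fin_supp : {pred lprod} :=
  fun f => `[< finite_set [set i | f i <> 0] >].
Fact fin_supp_closed : submod_closed fin_supp.
Proof.
split=> [|c f g]; rewrite /in_mem /= /fin_supp.
  apply/asboolP; rewrite [X in finite_set X](_ : _ = set0) //.
  by rewrite predeqE => i; split=> // /(_ erefl).
move=> /asboolP ff /asboolP fg; apply/asboolP.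
apply: (@sub_finite_set _ _ ([set i | f i <> 0] `|` [set i | g i <> 0])).
  move=> i /= h; apply: contrapT => /not_orP[/contrapT fi /contrapT gi].
  apply: h; change (c *: f i + g i = 0).
  by rewrite fi gi scaler0 addr0.
by rewrite finite_setU.
Qed.
HB.instance Definition _ :=
  GRing.isSubmodClosed.Build 'F_2 lprod fin_supp fin_supp_closed.

Record lsum : Type := LSum { lsum_val :> lprod; _ : lsum_val \in fin_supp }.
HB.instance Definition _ := [isSub for lsum_val].
HB.instance Definition _ := [Choice of lsum by <:].
HB.instance Definition _ := [SubChoice_isSubLmodule of lsum by <:].
End LinearSum.

Section DirectSum.
Variables (I : Type) (M : I -> pmod).
Implicit Types a b c z : grade.

Fact dsum_map_proof a b (ab : (a <= b)%O) (x : lsum (fun i => M i a)) :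
  ((fun i => pmap (M i) ab (val x i)) : lprod (fun i => M i b)) \in
    @fin_supp I (fun i => M i b).
Proof.
apply/asboolP; have /asboolP := valP x; apply: sub_finite_set => i /= h xi.
by apply: h; rewrite xi linear0.
Qed.
Definition dsum_map a b (ab : (a <= b)%O) (x : lsum (fun i => M i a)) :
  lsum (fun i => M i b) := LSum (dsum_map_proof ab x).
Fact dsum_map_linear a b (ab : (a <= b)%O) : linear (dsum_map ab).
Proof.
move=> c x y; apply: val_inj; apply: functional_extensionality_dep => i /=.
exact: linearP.
Qed.
HB.instance Definition _ a b (ab : (a <= b)%O) :=
  GRing.isLinear.Build 'F_2 (lsum (fun i => M i a)) (lsum (fun i => M i b)) _
    (dsum_map ab) (dsum_map_linear ab).
Fact dsum_map_id a (x : lsum (fun i => M i a)) : dsum_map (lexx a) x = x.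
Proof.
by apply: val_inj; apply: functional_extensionality_dep => i /=; apply: pmap_id.
Qed.
Fact dsum_map_comp a b c (ab : (a <= b)%O) (bc : (b <= c)%O)
    (x : lsum (fun i => M i a)) :
  dsum_map (le_trans ab bc) x = dsum_map bc (dsum_map ab x).
Proof.
apply: val_inj; apply: functional_extensionality_dep => i /=.
exact: pmap_comp.
Qed.
Definition pdsum : pmod :=
  @PMod (fun z => lsum (fun i => M i z)) (fun a b ab => dsum_map ab)
    dsum_map_id dsum_map_comp.
End DirectSum.

(* E^u_z is realised as the subspace of k = 'F_2 that is all of k if u <= z and
   0 otherwise, so that val : E^u_z -> k commutes with the structure maps. *)
Section Elementary.
Variable u : grade.
Implicit Types a b c z : grade.

Definition elem_pred z : {pred ('F_2)^o} := fun x => (u <= z)%O || (x == 0).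
Fact elem_pred_closed z : submod_closed (elem_pred z).
Proof.
split=> [|c x y]; rewrite /in_mem /= /elem_pred ?eqxx ?orbT //.
by case: (u <= z)%O => //= /eqP-> /eqP->; rewrite scaler0 addr0.
Qed.
HB.instance Definition _ z :=
  GRing.isSubmodClosed.Build 'F_2 ('F_2)^o (elem_pred z) (elem_pred_closed z).

Record espace z : Type := ESpace { eval :> ('F_2)^o; _ : eval \in elem_pred z }.
HB.instance Definition _ z := [isSub for @eval z].
HB.instance Definition _ z := [Choice of espace z by <:].
HB.instance Definition _ z := [SubChoice_isSubLmodule of espace z by <:].

Fact elem_map_proof a b (ab : (a <= b)%O) (x : espace a) :
  val x \in elem_pred b.
Proof.
have := valP x; rewrite /in_mem /= /elem_pred => /orP[ua|->]; last by rewrite orbT.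
by rewrite (le_trans ua ab).
Qed.
Definition elem_map a b (ab : (a <= b)%O) (x : espace a) : espace b :=
  ESpace (elem_map_proof ab x).
Fact elem_map_linear a b (ab : (a <= b)%O) : linear (elem_map ab).
Proof. by move=> c x y; apply: val_inj. Qed.
HB.instance Definition _ a b (ab : (a <= b)%O) :=
  GRing.isLinear.Build 'F_2 (espace a) (espace b) _ (elem_map ab)
    (elem_map_linear ab).
Fact elem_map_id a (x : espace a) : elem_map (lexx a) x = x.
Proof. exact: val_inj. Qed.
Fact elem_map_comp a b c (ab : (a <= b)%O) (bc : (b <= c)%O) (x : espace a) :
  elem_map (le_trans ab bc) x = elem_map bc (elem_map ab x).
Proof. exact: val_inj. Qed.
Definition elem : pmod :=
  @PMod espace (fun a b ab => elem_map ab) elem_map_id elem_map_comp.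
End Elementary.

Definition free_on (I : Type) (u : I -> grade) : pmod :=
  pdsum (fun i => elem (u i)).

Definition is_free (F : pmod) : Prop :=
  exists (I : Type) (u : I -> grade), isomorphic F (free_on u).

Section Generators.
Local Open Scope classical_set_scope.

(* The homogeneous elements of M; the grade is part of the element, so that the
   zero vectors of different grades are different elements. *)
Definition homog (M : pmod) : Type := {z : grade & M z}.

Definition homog_map (M N : pmod) (f : phom M N) (v : homog M) : homog N :=
  existT (fun z => N z : Type) (projT1 v) (f (projT1 v) (projT2 v)).

Inductive span (M : pmod) (S : set (homog M)) : forall z : grade, M z -> Prop :=
| span_gen (v : homog M) : S v -> span S (projT2 v)
| span_zero (z : grade) : span S (0 : M z)
| span_lin (z : grade) (c : 'F_2) (x y : M z) :
    span S x -> span S y -> span S (c *: x + y)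
| span_map (a b : grade) (ab : (a <= b)%O) (x : M a) :
    span S x -> span S (pmap M ab x).

Definition generates (M : pmod) (S : set (homog M)) : Prop :=
  forall (z : grade) (x : M z), span S x.

Definition minimal_generators (M : pmod) (S : set (homog M)) : Prop :=
  generates S /\ forall T, T `<=` S -> generates T -> T = S.

Definition basis (F : pmod) (B : set (homog F)) : Prop :=
  is_free F /\ minimal_generators B.

Definition presentation (F1 F0 : pmod) (p : phom F1 F0) (M : pmod) : Prop :=
  [/\ is_free F1, is_free F0 & isomorphic (pcoker p) M].

Definition minimal (F1 F0 : pmod) (p : phom F1 F0) : Prop :=
  let q := coker_proj p in
  (exists (B : set (homog F0)) (S : set (homog (pcoker p))),
     [/\ basis B, minimal_generators S & set_bij B S (homog_map q)]) /\
  (exists (B : set (homog F1)) (S : set (homog (pker q))),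
     [/\ basis B, minimal_generators S &
         set_bij B (homog_map (ker_incl q) @` S) (homog_map p)]).

Definition minimal_presentation (F1 F0 : pmod) (p : phom F1 F0) (M : pmod) :
    Prop :=
  presentation p M /\ minimal p.

(* A direct sum of maps id_H with H free is again such a map, so a single
   summand H covers any number of them. *)
Definition semi_minimal_presentation (F1 F0 : pmod) (p : phom F1 F0)
    (M : pmod) : Prop :=
  presentation p M /\
  exists (G1 G0 : pmod) (p' : phom G1 G0) (H : pmod),
    [/\ minimal_presentation p' M, is_free H &
        arrow_iso p (hom_sum2 p' (id_hom H))].
End Generators.

Definition colex (a b : grade) : bool :=
  (a.2 < b.2) || ((a.2 == b.2) && (a.1 <= b.1)).

Record annotated_matrix := AMatrix {
  nrows : nat;
  ncols : nat;
  row_grade : 'I_nrows -> grade;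
  col_grade : 'I_ncols -> grade;
  entries : 'M['F_2]_(nrows, ncols) }.

(* The first condition says that the matrix represents a homomorphism: the
   (i, j) entry is a homomorphism E^(col_grade j) -> E^(row_grade i), which is
   zero unless row_grade i <= col_grade j. *)
Record gmatrix := GMatrix {
  amatrix :> annotated_matrix;
  entries_homogeneous : forall i j,
    entries amatrix i j != 0 -> (row_grade i <= col_grade j)%O;
  rows_colex : forall i j : 'I_(nrows amatrix),
    (i <= j)%N -> colex (row_grade i) (row_grade j);
  cols_colex : forall i j : 'I_(ncols amatrix),
    (i <= j)%N -> colex (col_grade i) (col_grade j) }.

Section MatrixHom.
Variable P : gmatrix.
Implicit Types a b z : grade.

Let F1 : pmod := free_on (@col_grade P).
Let F0 : pmod := free_on (@row_grade P).

Fact mx_coord_proof z (x : F1 z) (i : 'I_(nrows P)) :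
  (\sum_j entries P i j * val (val x j) : ('F_2)^o) \in elem_pred (row_grade i) z.
Proof.
rewrite /in_mem /= /elem_pred; case: (boolP (row_grade i <= z)%O) => //= nle.
apply/eqP/big1 => j _; have [->|Pij] := eqVneq (entries P i j) 0.
  exact: mul0r.
have := valP (val x j); rewrite /in_mem /= /elem_pred => /orP[le|/eqP->].
  by rewrite (le_trans (entries_homogeneous Pij) le) in nle.
exact: mulr0.
Qed.
Definition mx_coord z (x : F1 z) (i : 'I_(nrows P)) : elem (row_grade i) z :=
  ESpace (mx_coord_proof x i).
Fact mx_fun_proof z (x : F1 z) :
  (mx_coord x : lprod (fun i : 'I_(nrows P) => elem (row_grade i) z)) \in
    @fin_supp _ (fun i : 'I_(nrows P) => elem (row_grade i) z).
Proof. by apply/asboolP/finite_finset. Qed.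
Definition mx_fun z (x : F1 z) : F0 z := LSum (mx_fun_proof x).
Fact mx_fun_linear z : linear (@mx_fun z).
Proof.
move=> c x y; apply: val_inj; apply: functional_extensionality_dep => i.
apply: val_inj => /=.
change (\sum_j entries P i j * (c * val (val x j) + val (val y j)) =
  c * (\sum_j entries P i j * val (val x j)) +
  \sum_j entries P i j * val (val y j) :> 'F_2).
rewrite mulr_sumr -big_split /=; apply: eq_bigr => j _.
by rewrite mulrDr mulrCA.
Qed.
HB.instance Definition _ z :=
  GRing.isLinear.Build 'F_2 (F1 z) (F0 z) _ (@mx_fun z) (@mx_fun_linear z).
Fact mx_fun_nat a b (ab : (a <= b)%O) (x : F1 a) :
  (@mx_fun b : {linear F1 b -> F0 b}) (pmap F1 ab x) =
  pmap F0 ab ((@mx_fun a : {linear F1 a -> F0 a}) x).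
Proof.
by apply: val_inj; apply: functional_extensionality_dep => i; apply: val_inj.
Qed.
Definition hom_of_gmatrix : phom F1 F0 :=
  @PHom F1 F0 (fun z => @mx_fun z) mx_fun_nat.
End MatrixHom.

Lemma F2_add_nz (x y : 'F_2) : x != 0 -> y != 0 -> x + y = 0.
Proof. by case: x y => [[|[|?]] ?] [[|[|?]] ?] // _ _; apply: val_inj. Qed.

Lemma iter_exhaust (T : Type) (step : T -> T) (stop inv : T -> Prop)
    (mu : T -> nat) (k : nat) (x : T) :
  inv x -> (mu x <= k)%N -> (forall y, mu y = 0%N -> stop y) ->
  (forall y, inv y -> inv (step y)) ->
  (forall y, inv y -> ~ stop y -> (mu (step y) < mu y)%N) ->
  (forall y, stop y -> step y = y) ->
  stop (iter k step x).
Proof.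
move=> invx lex stop0 inv_step lt_step fix_step.
elim: k x invx lex => [|k IHk] x invx lex.
  by apply: stop0; apply/eqP; rewrite -leqn0.
have [sx|nsx] := pselect (stop x).
  by have -> : iter k.+1 step x = x by elim: k.+1 => //= j ->; apply: fix_step.
rewrite iterSr; apply: IHk; first exact: inv_step.
by rewrite -ltnS; apply: leq_trans (lt_step _ invx nsx) lex.
Qed.

Section MultiChunk.
Variables (m n : nat) (rg : 'I_m -> grade) (cg : 'I_n -> grade).
Implicit Types (A : 'M['F_2]_(m, n)) (i k r : 'I_m) (c d : 'I_n).

Definition is_pivot A i c : bool :=
  (A i c != 0) && [forall k, (A k c != 0) ==> (k <= i)%N].

Definition is_local_pivot A i c : bool := is_pivot A i c && (rg i == cg c).

Definition local_negative A c : bool := [exists i, is_local_pivot A i c].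
Definition local_positive A i : bool := [exists c, is_local_pivot A i c].

Lemma add_pivot_lt A i c d k :
  is_pivot A i c -> is_pivot A i d -> A k c + A k d != 0 -> (k < i)%N.
Proof.
move=> /andP[cnz /forallP cmax] /andP[dnz /forallP dmax] nz.
rewrite ltn_neqAle; apply/andP; split.
  by apply: contra nz => /eqP/val_inj->; rewrite F2_add_nz.
have [ck|ck] := eqVneq (A k c) 0; last exact: (implyP (cmax k)).
by apply: (implyP (dmax k)); rewrite ck add0r in nz.
Qed.

Definition add_column A d c : 'M['F_2]_(m, n) :=
  \matrix_(i, k) (if k == c then A i c + A i d else A i k).

Definition phase1_reducer A c d : bool :=
  (d < c)%N && [exists i, is_local_pivot A i c && is_local_pivot A i d].

Definition phase1_step c A : 'M['F_2]_(m, n) :=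
  if [pick d | phase1_reducer A c d] is Some d then add_column A d c else A.

(* While loop of phase I for column c. The column picked by phase1_step is the
   only candidate in an actual run, because the columns before c have pairwise
   distinct local pivots once they have been processed. Every effective
   iteration strictly decreases the pivot of c, so that m iterations exhaust the
   loop: see phase1_columnP. *)
Definition phase1_column A c : 'M['F_2]_(m, n) := iter m (phase1_step c) A.

Lemma phase1_columnP A c d : ~~ phase1_reducer (phase1_column A c) c d.
Proof.
pose mu (B : 'M['F_2]_(m, n)) := \max_(i | B i c != 0) i.+1.
apply: (iter_exhaust (stop := fun B => forall d, ~~ phase1_reducer B c d)
  (inv := fun=> True) (mu := mu)) => //.
- by apply/bigmax_leqP => i _.
- move=> B /eqP; rewrite -leqn0 => /bigmax_leqP muB d'.
  apply/negP => /andP[_ /existsP[i /andP[/andP[/andP[nz _] _] _]]].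
  by have := muB i nz.
- move=> B _ nstop; rewrite /phase1_step; case: pickP => [d'|none]; last first.
    by case: nstop => d'; rewrite none.
  move=> /andP[dc /existsP[i /andP[/andP[pc _] /andP[pd _]]]].
  apply: (@leq_trans i.+1); last by apply: (leq_bigmax_cond i); case/andP: pc.
  rewrite ltnS; apply/bigmax_leqP => k; rewrite mxE eqxx => nz.
  exact: (add_pivot_lt pc pd nz).
- by move=> B sB; rewrite /phase1_step; case: pickP => // e; rewrite (negPf (sB e)).
Qed.

Definition phase1 A : 'M['F_2]_(m, n) := foldl phase1_column A (enum 'I_n).

(* In phase II the labels and local pivots are those of the matrix L obtained at
   the end of phase I. *)
Definition phase2_reducer (L : 'M['F_2]_(m, n)) A c (rd : 'I_m * 'I_n) : bool :=
  [&& local_positive L rd.1, A rd.1 c != 0,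
      [forall k, local_positive L k && (A k c != 0) ==> (k <= rd.1)%N] &
      is_local_pivot L rd.1 rd.2].

Definition phase2_step (L : 'M['F_2]_(m, n)) c A : 'M['F_2]_(m, n) :=
  if [pick rd | phase2_reducer L A c rd] is Some rd then add_column A rd.2 c
  else A.

(* While loop of phase II for column c. Every effective iteration strictly
   decreases the largest local positive row in which c is nonzero, so that m
   iterations exhaust the loop: see phase2_columnP. *)
Definition phase2_column (L : 'M['F_2]_(m, n)) A c : 'M['F_2]_(m, n) :=
  iter m (phase2_step L c) A.

Lemma phase2_columnP (L : 'M['F_2]_(m, n)) A c rd :
  ~~ local_negative L c ->
  (forall i d, local_negative L d -> A i d = L i d) ->
  ~~ phase2_reducer L (phase2_column L A c) c rd.
Proof.
move=> cglob AL; 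
pose mu (B : 'M['F_2]_(m, n)) :=
  \max_(i | local_positive L i && (B i c != 0)) i.+1.
apply: (iter_exhaust (stop := fun B => forall rd, ~~ phase2_reducer L B c rd)
  (inv := fun B => forall i d, local_negative L d -> B i d = L i d)
  (mu := mu)) => //.
- by apply/bigmax_leqP => i _.
- move=> B /eqP; rewrite -leqn0 => /bigmax_leqP muB rd'.
  by apply/negP => /and4P[pos nz _ _]; have := muB rd'.1; rewrite pos nz => /(_ isT).
- move=> B BL i d dneg; rewrite /phase2_step; case: pickP => [rd' _|_].
    rewrite mxE; case: eqP => [dc|_]; last exact: BL.
    by rewrite -dc dneg in cglob.
  exact: BL.
- move=> B BL nstop; rewrite /phase2_step; case: pickP => [rd'|none]; last first.
    by case: nstop => rd'; rewrite none.
  move=> /and4P[pos nz /forallP rmax lp].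
  apply: (@leq_trans rd'.1.+1); last by apply: (leq_bigmax_cond rd'.1); rewrite pos.
  have lneg : local_negative L rd'.2 by apply/existsP; exists rd'.1.
  have [/andP[Lnz /forallP Lmax] _] := andP lp.
  rewrite ltnS; apply/bigmax_leqP => k /andP[kpos]; rewrite mxE eqxx.
  rewrite (BL _ _ lneg) => knz.
  rewrite ltn_neqAle; apply/andP; split.
    by apply: contra knz => /eqP/val_inj->; rewrite F2_add_nz.
  have [Bk|Bk] := eqVneq (B k c) 0; last by apply: (implyP (rmax k)); rewrite kpos.
  by apply: (implyP (Lmax k)); rewrite Bk add0r in knz.
- by move=> B sB; rewrite /phase2_step; case: pickP => // e; rewrite (negPf (sB e)).
Qed.

Definition phase2 (L : 'M['F_2]_(m, n)) : 'M['F_2]_(m, n) :=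
  foldl (phase2_column L) L [seq c <- enum 'I_n | ~~ local_negative L c].

(* enum_val lists the remaining indices in increasing order. *)
Definition multi_chunk_mx (A : 'M['F_2]_(m, n)) : annotated_matrix :=
  let L := phase1 A in
  let Rows := [set i | ~~ local_positive L i] in
  let Cols := [set c | ~~ local_negative L c] in
  @AMatrix #|Rows| #|Cols| (fun x => rg (enum_val x)) (fun y => cg (enum_val y))
    (mxsub enum_val enum_val (phase2 L)).
End MultiChunk.

Definition multi_chunk (P : annotated_matrix) : annotated_matrix :=
  multi_chunk_mx (@row_grade P) (@col_grade P) (entries P).

(* Main.v *)
From HB Require Import structures.
From mathcomp Require Import all_boot all_order all_algebra.
From mathcomp Require Import boolp classical_sets functions cardinality.
From mathcomp Require Import zify.
Require Import Defs.

Set Implicit Arguments.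
Unset Strict Implicit.
Unset Printing Implicit Defensive.

Import Order.TTheory GRing.Theory.
Local Open Scope ring_scope.

(** Call radical elements of grade z the span of everything of grade < z.  By
    Nakayama's lemma a presentation P : F1 -> F0 of finitely generated free
    modules is minimal as soon as Im P and Ker P consist of radical elements.
    - Ker P is radical for a minimal P, hence also for a semi-minimal one, because
      the summands id_H contribute nothing to the kernel.
    - Multi-chunk yields M = P U with U a graded change of basis of F1; in M the
      block of local positive rows and local negative columns is triangular, and
      the global columns vanish on the local positive rows.  So Q has the same
      cokernel as P, and a split monomorphism between the free modules embeds
      Ker Q into Ker P, so that Ker Q is radical.
    - A global column has no entry in a row of its own grade, hence Im Q is
      radical. *)

(** * Generators modulo the radical *)

Section Span.
Variable M : pmod.
Implicit Types (S T : set (homog M)) (z : grade).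

Lemma homog_inj z (x y : M z) :
  existT (fun z => M z : Type) z x = existT (fun z => M z : Type) z y -> x = y.
Proof. by apply: Eqdep_dec.inj_pair2_eq_dec => a b; apply: eq_comparable. Qed.

Lemma pmap_refl z (zz : (z <= z)%O) (x : M z) : pmap M zz x = x.
Proof. by rewrite (bool_irrelevance zz (lexx z)) pmap_id. Qed.

Lemma addrr_F2 z (x : M z) : x + x = 0.
Proof.
rewrite -[x]scale1r -scalerDl (_ : 1 + 1 = 0 :> 'F_2) ?scale0r //.
exact: val_inj.
Qed.

Lemma spanZ S z c (x : M z) : span S x -> span S (c *: x).
Proof.
by move=> Sx; rewrite -[_ *: _]addr0; apply: span_lin => //; apply: span_zero.
Qed.

Lemma spanD S z (x y : M z) : span S x -> span S y -> span S (x + y).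
Proof. by move=> Sx Sy; rewrite -[x]scale1r; apply: span_lin. Qed.

Lemma span_sum S z (I : Type) (r : seq I) (P : pred I) (F : I -> M z) :
  (forall i, P i -> span S (F i)) -> span S (\sum_(i <- r | P i) F i).
Proof.
by move=> SF; apply: big_ind => //; [apply: span_zero | move=> x y; apply: spanD].
Qed.

Lemma span_trans S T z (x : M z) :
  (forall v, S v -> span T (projT2 v)) -> span S x -> span T x.
Proof.
move=> ST; elim=> {z x} [v Sv|z|z c x y _ Tx _ Ty|a b ab x _ Tx].
- exact: ST.
- exact: span_zero.
- exact: span_lin.
- exact: span_map.
Qed.

(** For [M] seen as a graded module over k[s, t], this is the grade [z] part of (s, t)M. *)
Definition rad z (x : M z) : Prop :=
  span [set v : homog M | (projT1 v < z)%O]%classic x.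

Lemma rad_map a b (ab : (a < b)%O) (x : M a) : rad (pmap M (ltW ab) x).
Proof.
apply: span_map.
exact: (@span_gen M [set v | (projT1 v < b)%O]%classic (existT _ a x)).
Qed.

End Span.

Section SpanHom.
Variables (M N : pmod) (f : phom M N).

Lemma span_hom (S : set (homog M)) z (x : M z) :
  span S x -> span (homog_map f @` S)%classic (f z x).
Proof.
elim=> {z x} [v Sv|z|z c x y _ fx _ fy|a b ab x _ fx].
- by apply: (@span_gen N _ (homog_map f v)); exists v.
- by rewrite linear0; apply: span_zero.
- by rewrite linearP; apply: span_lin.
- by rewrite pnat; apply: span_map.
Qed.

Lemma rad_hom z (x : M z) : rad x -> rad (f z x).
Proof.
move=> /span_hom; apply: span_trans => _ [v vz <-].
exact: (@span_gen N _ (homog_map f v)).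
Qed.

(** Each way of building an element of the span is replayed on preimages of the generators. *)
Lemma span_lift (S : set (homog M)) (T : set (homog N)) z (y : N z) :
  (T `<=` homog_map f @` S)%classic -> span T y ->
  exists2 x, span S x & f z x = y.
Proof.
move=> TS; elim=> {z y} [v /TS[w Sw <-]|z|z c x y _ [x' Sx <-] _ [y' Sy <-]
  |a b ab x _ [x' Sx <-]].
- by exists (projT2 w) => //; apply: span_gen.
- by exists 0; [apply: span_zero | rewrite linear0].
- by exists (c *: x' + y'); [apply: span_lin | rewrite linearP].
- by exists (pmap M ab x'); [apply: span_map | rewrite pnat].
Qed.

End SpanHom.

(** Excludes infinite descent: the module equal to k in every grade, with identity maps, is its own
    radical without being zero, so Nakayama's lemma fails for it. *)
Definition bounded_below (M : pmod) : Prop :=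
  exists z0, forall z (x : M z), ~~ (z0 <= z)%O -> x = 0.

(** The l1 distance; taken from the lower bound, it is the measure of the induction in Nakayama's
    lemma. *)
Definition grade_dist (a b : grade) : nat := absz (b.1 - a.1) + absz (b.2 - a.2).

Lemma grade_dist_lt (z a b : grade) :
  (z <= a)%O -> (a < b)%O -> (grade_dist z a < grade_dist z b)%N.
Proof.
case: z a b => [z1 z2] [a1 a2] [b1 b2]; rewrite lt_neqAle.
move=> /andP[/= za1 za2] /andP[ne /andP[/= ab1 ab2]].
rewrite /grade_dist /=; move: ne; rewrite -pair_eqE /= => ne.
lia.
Qed.

(* Nakayama's lemma; the induction on grades starts at the lower bound. *)
Lemma generates_mod_rad (M : pmod) (S : set (homog M)) :
  bounded_below M ->
  (forall z (x : M z), exists2 y, span S y & rad (x - y)) -> generates S.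
Proof.
move=> [z0 M0] Srad z x; have [n] := ubnP (grade_dist z0 z).
elim: n z x => // n IHn z x; rewrite ltnS => zn.
have [y Sy xy] := Srad z x; rewrite -(subrK y x); apply: spanD => //.
apply: span_trans xy => v vz.
have [z0v|z0v] := boolP (z0 <= projT1 v)%O.
  exact: IHn (leq_trans (grade_dist_lt z0v vz) zn).
by rewrite (M0 _ (projT2 v) z0v); apply: span_zero.
Qed.

(** * Minimal generating sets under surjections with radical kernel *)

Section MinimalImage.
Variables (M N : pmod) (q : phom M N) (B : set (homog M)).
Hypothesis bM : bounded_below M.
Hypothesis q_surj : forall z y, exists x, q z x = y.
Hypothesis q_rad : forall z (x : M z), q z x = 0 -> rad x.
Hypothesis minB : minimal_generators B.
Local Open Scope classical_set_scope.

(** If a subset [T] of the image generates [N], the elements of [B] over [T] generate [M] modulo the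
    radical, hence generate [M]; by minimality they are all of [B]. *)
Lemma minimal_generators_image : minimal_generators (homog_map q @` B).
Proof.
have [genB minB'] := minB; split.
  by move=> z y; have [x <-] := q_surj y; apply: span_hom; apply: genB.
move=> T TB genT; pose B' := B `&` homog_map q @^-1` T.
have TB' : T `<=` homog_map q @` B'.
  by move=> t Tt; have [b Bb bt] := TB _ Tt; exists b => //; split; rewrite //= bt.
have B'B : B' = B.
  apply: minB'; first by move=> b [].
  apply: generates_mod_rad => // z x.
  have [y Sy qy] := span_lift TB' (genT z (q z x)).
  by exists y => //; apply: q_rad; rewrite linearB qy subrr.
by apply/seteqP; split=> // _ [b Bb <-]; move: Bb; rewrite -B'B => -[].
Qed.

(** If [b] and [b'] had the same image, their difference would be radical, so [b'] could replace [b]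
    and [B] without [b] would still generate. *)
Lemma minimal_generators_inj : {in B &, injective (homog_map q)}.
Proof.
move=> b b' /set_mem Bb /set_mem Bb' qbb'; apply: contrapT => bb'.
have [genB minB'] := minB.
suff /(minB' (B `\ b)) gB : generates (B `\ b).
  have BbB : B `\ b `<=` B by move=> x [].
  by have : (B `\ b) b; [rewrite gB | case=> _ /(_ erefl)].
apply: generates_mod_rad => // z x.
elim: (genB z x) => {z x} [v Bv|z|z c x y _ [x' Sx rx] _ [y' Sy ry]
  |a e ae x _ [x' Sx rx]].
- have [->|vb] := pselect (v = b); last first.
    exists (projT2 v); last by rewrite subrr; apply: span_zero.
    by apply: span_gen; split.
  case: b b' Bb Bb' qbb' bb' {genB minB' v Bv} => [z b] [z' b'] Bb Bb' qbb' bb'.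
  have /= zz' := congr1 (@projT1 _ _) qbb'; subst z'.
  exists b'; first by apply: (@span_gen _ _ (existT _ z b')); split=> // /esym.
  by apply: q_rad; rewrite linearB (homog_inj qbb') subrr.
- by exists 0; rewrite ?subrr; apply: span_zero.
- exists (c *: x' + y'); first exact: span_lin.
  by rewrite opprD addrACA -scalerBr; apply: span_lin.
- exists (pmap M ae x'); first exact: span_map.
  rewrite -linearB; have [ea|ne] := eqVneq a e.
    by subst e; rewrite pmap_refl.
  have lt : (a < e)%O by rewrite lt_neqAle ne.
  by rewrite (bool_irrelevance ae (ltW lt)); apply: rad_map.
Qed.

End MinimalImage.

Section KernelRad.
Variables (M : pmod) (B : set (homog M)).
Local Open Scope classical_set_scope.

(** Generators of smaller grade enter only through structure maps that land in the radical. Over the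
    field with two elements a list, possibly with repetitions, encodes the remaining combination. *)
Lemma span_top z (x : M z) : span B x ->
  exists2 l : seq (M z),
    forall b, b \in l -> B (existT (fun z => M z : Type) z b)
    & rad (x - \sum_(b <- l) b).
Proof.
elim=> {z x} [[z v] Bv|z|z c x y _ [l lB rx] _ [l' lB' ry]|a e ae x _ [l lB rx]].
- exists [:: v] => [b|]; first by rewrite inE => /eqP->.
  by rewrite big_seq1 subrr; apply: span_zero.
- by exists [::] => //; rewrite big_nil subrr; apply: span_zero.
- exists (if c == 0 then l' else l ++ l').
    case: ifP => _ b; first exact: lB'.
    by rewrite mem_cat => /orP[/lB|/lB'].
  case: eqP => [->|/eqP c0]; first by rewrite scale0r add0r.
  have -> : c = 1 by case: c c0 => -[|[|?]] ? // _; apply: val_inj.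
  by rewrite scale1r big_cat opprD addrACA; apply: spanD.
- have [ea|ne] := eqVneq a e.
    by subst e; exists l => //; rewrite pmap_refl.
  exists [::] => //; rewrite big_nil subr0.
  have lt : (a < e)%O by rewrite lt_neqAle ne.
  by rewrite (bool_irrelevance ae (ltW lt)); apply: rad_map.
Qed.

(** Structure maps only raise grades. *)
Lemma span_below z (x : M z) :
  span B x -> span (B `&` [set v | (projT1 v <= z)%O]) x.
Proof.
elim=> {z x} [v Bv|z|z c x y _ Tx _ Ty|a b ab x _ Tx].
- by apply: span_gen; split=> /=.
- exact: span_zero.
- exact: span_lin.
- apply: span_map; apply: (span_trans _ Tx) => v [Bv va]; apply: span_gen.
  by split=> //=; apply: le_trans va ab.
Qed.

(** Modulo the radical, [x] is a sum of elements of [B] of grade [z]. Once repetitions cancel,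
    either the sum is empty or it contains some [b] exactly once, which can be exchanged against
    [x]. *)
Lemma rad_or_exchange z (x : M z) : generates B ->
  rad x \/ exists2 b, B (existT (fun z => M z : Type) z b) &
    span (B `\ existT (fun z => M z : Type) z b) (x - b).
Proof.
move=> genB; have [l] := span_top (genB z x).
have [n] := ubnP (size l); elim: n l => // n IHn [|b l].
  by move=> _ _; rewrite big_nil subr0; left.
rewrite /= ltnS => ln lB; rewrite big_cons => rx.
(* A second copy of [b] cancels the first in characteristic 2, and the list gets shorter. *)
have [bl|bl] := boolP (b \in l).
  apply: (IHn (rem b l)).
  - by rewrite size_rem //; apply: leq_ltn_trans (leq_pred _) ln.
  - by move=> b' /mem_rem b'l; apply: lB; rewrite inE b'l orbT.
  by move: rx; rewrite (perm_big _ (perm_to_rem bl)) big_cons addrA addrr_F2 add0r.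
right; exists b; first by apply: lB; rewrite mem_head.
(* The radical part of [x - b] needs only generators of grade below [z], so never [b]; the other
   part is the sum of the rest of the list. *)
rewrite -(subrK (b + \sum_(b <- l) b) x) -addrA; apply: spanD.
  apply: (span_trans _ rx) => v vz.
  apply: (span_trans _ (span_below (genB _ (projT2 v)))) => w [Bw wv]; apply: span_gen.
  by split=> // wb; move: (le_lt_trans wv vz); rewrite wb /= ltxx.
rewrite [b + _]addrC addrK big_seq; apply: span_sum => b' b'l.
apply: (@span_gen _ _ (existT _ z b')).
split; first by apply: lB; rewrite inE b'l orbT.
by move=> /homog_inj bb'; rewrite -bb' b'l in bl.
Qed.

End KernelRad.

Lemma ker_span_lift (M N : pmod) (f : phom M N) (S : set (homog (pker f)))
    z (w : pker f z) :
  span (homog_map (ker_incl f) @` S)%classic (val w) -> span S w.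
Proof.
move=> Sw; have [w' Sw' ww'] := span_lift (@subset_refl _ _) Sw.
by rewrite -(val_inj ww').
Qed.

(* If x in Ker p' were not in the radical, a basis element of its grade could
   be exchanged against x, and its image would be a redundant generator. *)
Lemma minimal_ker_rad (G1 G0 : pmod) (p : phom G1 G0) z (x : G1 z) :
  minimal p -> p z x = 0 -> rad x.
Proof.
move=> [_ [B [S [[_ [genB _]] [genS minS] [pBS pinj pSB]]]]] px.
have [//|[b Bb xb]] := rad_or_exchange x genB.
pose hb : homog G1 := existT (fun z => G1 z : Type) z b.
have [s Ss sb] := pBS hb Bb.
suff /(minS (S `\ s)%classic) SE : generates (S `\ s)%classic.
  have SsS : (S `\ s `<=` S)%classic by move=> y [].
  by have : (S `\ s)%classic s; [rewrite SE | case=> _ /(_ erefl)].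
move=> a w; apply: (span_trans _ (genS a w)) => t St.
have [->|ts] := pselect (t = s); last by apply: span_gen.
apply: ker_span_lift.
change (span (homog_map (ker_incl (coker_proj p)) @` (S `\ s))%classic
  (projT2 (homog_map (ker_incl (coker_proj p)) s))).
rewrite sb /= (_ : p z b = - p z (x - b)); last by rewrite linearB px sub0r opprK.
rewrite -scaleN1r; apply: spanZ; apply: (span_trans _ (span_hom p xb)).
move=> _ [c [Bc cb] <-]; apply: span_gen; have [t' St' tc] := pBS c Bc.
(* Injectivity of [p] on [B] keeps the images of the other basis elements different from [s]. *)
exists t' => //; split=> // ts'; apply: cb; apply: pinj; rewrite ?inE //.
by rewrite -tc ts' sb.
Qed.

(** * Isomorphisms of persistence modules *)

Section Composition.
Variables (M N L : pmod) (f : phom M N) (g : phom N L).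

Lemma phom_comp_nat (a b : grade) (ab : (a <= b)%O) (x : M a) :
  (g b \o f b : {linear M b -> L b}) (pmap M ab x) =
  pmap L ab ((g a \o f a : {linear M a -> L a}) x).
Proof. by rewrite /= !pnat. Qed.

Definition phom_comp : phom M L := @PHom M L (fun z => g z \o f z) phom_comp_nat.
End Composition.

Lemma isomorphic_trans (M N L : pmod) :
  isomorphic M N -> isomorphic N L -> isomorphic M L.
Proof.
move=> [f [f' ff']] [g [g' gg']].
exists (phom_comp f g), (phom_comp g' f') => z.
have [fK fK'] := ff' z; have [gK gK'] := gg' z.
by split=> x /=; [rewrite gK fK | rewrite fK' gK'].
Qed.

Lemma isomorphic_refl (M : pmod) : isomorphic M M.
Proof. by exists (id_hom M), (id_hom M). Qed.

Section LeftInjection.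
Variables M N : pmod.

Definition inl_fun z (x : M z) : M z * N z := (x, 0).
Lemma inl_fun_linear z : linear (@inl_fun z).
Proof.
move=> c x y; rewrite /inl_fun.
change ((c *: x + y, 0) = (c *: x + y, c *: 0 + 0) :> M z * N z).
by rewrite scaler0 addr0.
Qed.
HB.instance Definition _ z :=
  GRing.isLinear.Build 'F_2 (M z) (M z * N z)%type _ (@inl_fun z)
    (@inl_fun_linear z).
Lemma inl_nat (a b : grade) (ab : (a <= b)%O) (x : M a) :
  (@inl_fun b : {linear M b -> psum2 M N b}) (pmap M ab x) =
  pmap (psum2 M N) ab ((@inl_fun a : {linear M a -> psum2 M N a}) x).
Proof. by rewrite /= /inl_fun /sum2_map /= linear0. Qed.
Definition pinl : phom M (psum2 M N) :=
  @PHom M (psum2 M N) (fun z => @inl_fun z) inl_nat.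
End LeftInjection.

(** Transported to [hom_sum2 p' (id_hom H)], a kernel element has zero component in [H], so it comes
    from Ker [p'] along [pinl]; homomorphisms preserve the radical. *)
Lemma semi_minimal_ker_rad (F1 F0 M : pmod) (p : phom F1 F0) z (x : F1 z) :
  semi_minimal_presentation p M -> p z x = 0 -> rad x.
Proof.
move=> [_ [G1 [G0 [p' [H [[_ minp'] _ [a [b [[a' aK] _ abp]]]]]]]]] px.
have /esym := abp z x; rewrite px linear0 => -[p'x ax2].
have ra : rad (a z x).
  rewrite (_ : a z x = pinl G1 H z (a z x).1).
    by apply: rad_hom; apply: minimal_ker_rad p'x.
  by rewrite [LHS]surjective_pairing ax2.
by have [aK' _] := aK z; rewrite -(aK' x); apply: rad_hom.
Qed.

Section BijectiveHom.
Variables (M N : pmod) (f : phom M N) (g : forall z, N z -> M z).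
Hypotheses (fK : forall z, cancel (f z) (@g z))
  (gK : forall z, cancel (@g z) (f z)).

Lemma inverse_linear z : linear (@g z).
Proof. by move=> c x y; apply: (can_inj (@fK z)); rewrite linearP !gK. Qed.
HB.instance Definition _ z :=
  GRing.isLinear.Build 'F_2 (N z) (M z) _ (@g z) (@inverse_linear z).
Lemma inverse_nat (a b : grade) (ab : (a <= b)%O) (x : N a) :
  (@g b : {linear N b -> M b}) (pmap N ab x) =
  pmap M ab ((@g a : {linear N a -> M a}) x).
Proof. by apply: (can_inj (@fK b)); rewrite pnat /= !gK. Qed.

Lemma cancel_is_iso : is_iso f.
Proof.
exists (@PHom N M (fun z => @g z) inverse_nat) => z.
by split; [apply: fK | apply: gK].
Qed.
End BijectiveHom.

Lemma bijective_is_iso (M N : pmod) (f : phom M N) :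
  (forall z x, f z x = 0 -> x = 0) -> (forall z y, exists x, f z x = y) ->
  is_iso f.
Proof.
move=> finj fsurj; pose g z y := projT1 (cid (fsurj z y)).
have gK z : cancel (g z) (f z) by move=> y; rewrite /g; case: cid.
apply: (@cancel_is_iso _ _ f g) => // z x; apply/eqP; rewrite -subr_eq0.
by apply/eqP/finj; rewrite linearB gK subrr.
Qed.

Section CokernelMap.
Variables (G1 G0 F1 F0 : pmod) (q : phom G1 G0) (p : phom F1 F0).
Variable h : phom G0 F0.
Hypothesis h_im : forall z x, exists t, h z (q z x) = p z t.

(** The choice of representative is immaterial because [h] maps Im [q] into Im [p]; see
    [coker_fun_proj]. *)
Definition coker_fun z (y : pcoker q z) : pcoker p z :=
  coker_proj p z (h z (lcoker_repr y)).

Lemma coker_fun_proj z (y : G0 z) :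
  coker_fun (coker_proj q z y) = coker_proj p z (h z y).
Proof.
apply/lcoker_piP; rewrite -linearB.
have /lcoker_piP[s <-] := lcoker_reprK (coker_proj q z y).
by have [t ->] := h_im s; exists t.
Qed.

Lemma coker_fun_linear z : linear (@coker_fun z).
Proof.
move=> c x y; rewrite -(lcoker_reprK x) -(lcoker_reprK y).
change (lcoker_pi (q z) ?x) with (coker_proj q z x).
by rewrite -linearP !coker_fun_proj !linearP.
Qed.
HB.instance Definition _ z :=
  GRing.isLinear.Build 'F_2 (pcoker q z) (pcoker p z) _ (@coker_fun z)
    (@coker_fun_linear z).
Lemma coker_fun_nat (a b : grade) (ab : (a <= b)%O) (x : pcoker q a) :
  (@coker_fun b : {linear pcoker q b -> pcoker p b}) (pmap (pcoker q) ab x) =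
  pmap (pcoker p) ab ((@coker_fun a : {linear pcoker q a -> pcoker p a}) x).
Proof.
rewrite -(lcoker_reprK x) -[lcoker_pi _ _]/(coker_proj q a _) -pnat /=.
by rewrite !coker_fun_proj /= coker_map_pi pnat.
Qed.
Definition pcoker_hom : phom (pcoker q) (pcoker p) :=
  @PHom _ _ (fun z => @coker_fun z) coker_fun_nat.

(** The two hypotheses are injectivity and surjectivity of the induced map: the preimage of Im [p]
    under [h] lies in Im [q], and Im [h] + Im [p] is everything. *)
Lemma pcoker_isomorphic :
  (forall z y t, h z y = p z t -> exists s, q z s = y) ->
  (forall z x, exists y t, x = h z y + p z t) ->
  isomorphic (pcoker q) (pcoker p).
Proof.
move=> hinj hsurj; exists pcoker_hom; apply: bijective_is_iso => z y.
  rewrite -(lcoker_reprK y) => /= yE.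
  have : coker_proj p z (h z (lcoker_repr y)) = coker_proj p z 0.
    by rewrite linear0 -coker_fun_proj.
  move=> /lcoker_piP[t]; rewrite subr0 => /esym/hinj[s <-].
  by rewrite -(linear0 (coker_proj q z)); apply/lcoker_piP; exists s; rewrite subr0.
have [x [t E]] := hsurj z (lcoker_repr y).
exists (coker_proj q z x); rewrite /= coker_fun_proj -(lcoker_reprK y) E.
by apply/lcoker_piP; exists (- t); rewrite linearN opprD addNKr.
Qed.
End CokernelMap.

(** * Free modules in coordinates *)

Lemma free_on_is_free (I : Type) (u : I -> grade) : is_free (free_on u).
Proof. by exists I, u; apply: isomorphic_refl. Qed.

Section Coordinates.
Variables (n : nat) (u : 'I_n -> grade).
Implicit Types (z : grade) (v : 'cV['F_2]_n).

(** All grades share one coordinate space, in which structure maps act as the identity and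
    homomorphisms as matrices. *)
Definition coords z (x : free_on u z) : 'cV['F_2]_n :=
  \col_i (val (val x i) : 'F_2).

Lemma coords_linear z : linear (@coords z).
Proof. by move=> c x y; apply/matrixP => i j; rewrite !mxE. Qed.
HB.instance Definition _ z :=
  GRing.isLinear.Build 'F_2 (free_on u z) 'cV['F_2]_n _ (@coords z)
    (@coords_linear z).

Lemma coordsD z (x y : free_on u z) : coords (x + y) = coords x + coords y.
Proof. exact: linearD. Qed.

Lemma coords_inj z : injective (@coords z).
Proof.
move=> x y /matrixP xy; apply: val_inj; apply: functional_extensionality_dep.
by move=> i; apply: val_inj; have := xy i 0; rewrite !mxE.
Qed.

Lemma coords_pmap (a b : grade) (ab : (a <= b)%O) (x : free_on u a) :
  coords (pmap (free_on u) ab x) = coords x.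
Proof. by apply/matrixP => i j; rewrite !mxE. Qed.

Lemma coords_supp z (x : free_on u z) i : coords x i 0 != 0 -> (u i <= z)%O.
Proof.
rewrite mxE; have := valP (val x i); rewrite /in_mem /= /elem_pred.
by case/orP => // /eqP->; rewrite eqxx.
Qed.

Lemma of_coords_proof z v i :
  (if (u i <= z)%O then v i 0 else 0 : ('F_2)^o) \in elem_pred (u i) z.
Proof. by rewrite /in_mem /= /elem_pred; case: ifP => //; rewrite eqxx. Qed.

Lemma of_coords_fin_supp z v :
  ((fun i => ESpace (of_coords_proof z v i)) : lprod (fun i => elem (u i) z))
    \in @fin_supp _ (fun i => elem (u i) z).
Proof. by apply/asboolP/finite_finset. Qed.

(** Total by truncation: entries of generators not yet present at [z] are replaced by 0. *)
Definition of_coords z v : free_on u z := LSum (of_coords_fin_supp z v).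

Lemma of_coordsE z v i :
  coords (of_coords z v) i 0 = if (u i <= z)%O then v i 0 else 0.
Proof. by rewrite mxE. Qed.

Lemma of_coordsK z v :
  (forall i, v i 0 != 0 -> (u i <= z)%O) -> coords (of_coords z v) = v.
Proof.
move=> vz; apply/matrixP => i j; rewrite ord1 of_coordsE.
by case: ifP => // /negbT; apply: contraNeq; rewrite eq_sym; apply: vz.
Qed.

Definition unit_elt z i : free_on u z := of_coords z (delta_mx i 0).

Lemma coords_unit_elt z i : (u i <= z)%O -> coords (unit_elt z i) = delta_mx i 0.
Proof.
by move=> uz; apply: of_coordsK => k; rewrite mxE andbT; have [->|] := eqVneq k i.
Qed.

Lemma span_coords (S : set (homog (free_on u))) z (x : free_on u z) :
  (forall i, coords x i 0 != 0 -> span S (unit_elt z i)) -> span S x.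
Proof.
move=> Sx; have -> : x = \sum_(i | coords x i 0 != 0) unit_elt z i.
  apply: coords_inj; rewrite linear_sum /=; apply/matrixP => i j.
  rewrite ord1 summxE; have [xi0|xi0] := eqVneq (coords x i 0) 0.
    rewrite xi0 big1 // => k xk; rewrite coords_unit_elt ?(coords_supp xk) //.
    rewrite mxE andbT; have [ik|//] := eqVneq i k.
    by rewrite -ik xi0 eqxx in xk.
  rewrite (bigD1 i) //= coords_unit_elt ?(coords_supp xi0) //.
  rewrite big1 => [|k /andP[xk ki]]; last first.
    rewrite coords_unit_elt ?(coords_supp xk) //.
    by rewrite mxE andbT eq_sym (negPf ki).
  rewrite addr0 [RHS]mxE !eqxx; move: xi0; case: (coords x i 0) => -[|[|?]] // ? _.
  exact: val_inj.
by apply: span_sum => i; apply: Sx.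
Qed.

Lemma unit_elt_pmap (a b : grade) (ab : (a <= b)%O) i : (u i <= a)%O ->
  pmap (free_on u) ab (unit_elt a i) = unit_elt b i.
Proof.
move=> ua; apply: coords_inj; rewrite coords_pmap !coords_unit_elt //.
exact: le_trans ab.
Qed.

(** Every generator that occurs in [x] then has grade strictly below [z], so its unit vector is
    pushed up from there. *)
Lemma rad_coords z (x : free_on u z) :
  (forall i, u i = z -> coords x i 0 = 0) -> rad x.
Proof.
move=> xz; apply: span_coords => i xi.
have lt : (u i < z)%O.
  rewrite lt_neqAle (coords_supp xi) andbT.
  by apply: contra xi => /eqP/xz->.
by rewrite -(unit_elt_pmap (ltW lt)) //; apply: rad_map.
Qed.

Definition std_basis : set (homog (free_on u)) :=
  range (fun i => existT (fun z => free_on u z : Type) (u i) (unit_elt (u i) i)).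

Lemma std_basis_generates : generates std_basis.
Proof.
move=> z x; apply: span_coords => i /coords_supp uz.
rewrite -(unit_elt_pmap uz) //; apply: span_map.
by apply: (@span_gen _ _ (existT _ (u i) _)); exists i.
Qed.

Lemma std_basis_basis : basis std_basis.
Proof.
split; first exact: free_on_is_free.
split; first exact: std_basis_generates.
move=> T TB genT; apply/seteqP; split=> // _ [i _ <-].
apply: contrapT => Ti.
(* Without generator [i], coordinate [i] vanishes on the whole span, yet it is 1 on the unit
   vector. *)
suff T0 z (x : free_on u z) : span T x -> coords x i 0 = 0.
  have := T0 _ _ (genT _ (unit_elt (u i) i)).
  by rewrite coords_unit_elt // mxE !eqxx.
elim=> {z x} [v Tv|z|z c x y _ x0 _ y0|a b ab x _ x0].
- have [k _ kv] := TB _ Tv; move: Tv; rewrite -kv /= coords_unit_elt // mxE.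
  by case: eqP => // <-.
- by rewrite linear0 mxE.
- by rewrite linearP mxE [X in X + _]mxE x0 y0 mulr0 addr0.
- by rewrite coords_pmap.
Qed.

Lemma free_on_bounded_below : bounded_below (free_on u).
Proof.
(* The initial value 0 can only lower the bound, and serves for [n = 0]. *)
pose m1 := \big[Order.min/0]_i (u i).1; pose m2 := \big[Order.min/0]_i (u i).2.
exists (m1, m2) => z x nz; apply: coords_inj; rewrite linear0.
apply/matrixP => i j; rewrite ord1 [RHS]mxE; apply/eqP.
apply: contraNT nz => /coords_supp; apply: le_trans.
by rewrite leEprod /=; apply/andP; split; apply: bigmin_le.
Qed.

End Coordinates.

Definition graded m n (u : 'I_m -> grade) (v : 'I_n -> grade)
  (A : 'M['F_2]_(m, n)) : Prop := forall i j, A i j != 0 -> (u i <= v j)%O.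

Lemma graded_mulmx m n p (u : 'I_m -> grade) (v : 'I_n -> grade)
    (w : 'I_p -> grade) A B :
  graded u v A -> graded v w B -> graded u w (A *m B).
Proof.
move=> gA gB i j; rewrite mxE; apply: contraNT => uw.
apply/eqP/big1 => k _; have [->|Aik] := eqVneq (A i k) 0; first exact: mul0r.
have [->|Bkj] := eqVneq (B k j) 0; first exact: mulr0.
by rewrite (le_trans (gA _ _ Aik) (gB _ _ Bkj)) in uw.
Qed.

(** A vector of grade [z] is a graded matrix with a single column of grade [z]. *)
Lemma graded_mulmx_supp m n (u : 'I_m -> grade) (v : 'I_n -> grade) A z
    (x : 'cV_n) :
  graded u v A -> (forall i, x i 0 != 0 -> (v i <= z)%O) ->
  forall i, (A *m x) i 0 != 0 -> (u i <= z)%O.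
Proof.
move=> gA xz i; apply: (@graded_mulmx _ _ _ u v (fun=> z) A x gA) => k j.
by rewrite ord1; apply: xz.
Qed.

(** * Homomorphisms given by graded matrices *)

Section MatrixHom.
Variables (m n : nat) (u : 'I_m -> grade) (v : 'I_n -> grade).
Variables (A : 'M['F_2]_(m, n)) (gA : graded u v A).

Definition mxhom_fun z (x : free_on v z) : free_on u z :=
  of_coords u z (A *m coords x).

Lemma coords_mxhom_fun z (x : free_on v z) :
  coords (mxhom_fun x) = A *m coords x.
Proof.
by apply: of_coordsK; apply: graded_mulmx_supp gA _ => i; apply: coords_supp.
Qed.

Lemma mxhom_linear z : linear (@mxhom_fun z).
Proof.
move=> c x y; apply: coords_inj; rewrite linearP /= !coords_mxhom_fun linearP /=.
by rewrite mulmxDr scalemxAr.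
Qed.
HB.instance Definition _ z :=
  GRing.isLinear.Build 'F_2 (free_on v z) (free_on u z) _ (@mxhom_fun z)
    (@mxhom_linear z).
Lemma mxhom_nat (a b : grade) (ab : (a <= b)%O) (x : free_on v a) :
  (@mxhom_fun b : {linear free_on v b -> free_on u b}) (pmap (free_on v) ab x) =
  pmap (free_on u) ab ((@mxhom_fun a : {linear free_on v a -> free_on u a}) x).
Proof.
by apply: coords_inj; rewrite coords_mxhom_fun !coords_pmap coords_mxhom_fun.
Qed.
Definition mxhom : phom (free_on v) (free_on u) :=
  @PHom _ _ (fun z => @mxhom_fun z) mxhom_nat.

Lemma coords_mxhom z (x : free_on v z) : coords (mxhom z x) = A *m coords x.
Proof. exact: coords_mxhom_fun. Qed.
End MatrixHom.

Lemma coords_hom_of_gmatrix (P : gmatrix) z x :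
  coords (hom_of_gmatrix P z x) = entries P *m coords x.
Proof.
apply/matrixP => i j; rewrite mxE /= mxE; apply: eq_bigr => k _.
by rewrite [coords x k j]mxE.
Qed.

(** * Invariants of the algorithm *)

Lemma iter_invariant (T : Type) (f : T -> T) (Inv : T -> Prop) k x :
  (forall y, Inv y -> Inv (f y)) -> Inv x -> Inv (iter k f x).
Proof. by move=> If Ix; elim: k => //= k; apply: If. Qed.

Lemma sorted_enum_ord n : sorted (fun i j : 'I_n => i < j)%N (enum 'I_n).
Proof.
by have := iota_ltn_sorted 0 n; rewrite -val_enum_ord sorted_map.
Qed.

Lemma enum_val_lt n (A : {set 'I_n}) (x y : 'I_#|A|) :
  (x < y)%N -> (enum_val x < enum_val y)%N.
Proof.
move=> xy; have sA : sorted (fun i j : 'I_n => i < j)%N (enum A).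
  rewrite /(enum_mem (mem A)) -enumT.
  apply: sorted_filter; first by move=> i j k; apply: ltn_trans.
  exact: sorted_enum_ord.
have i0 := enum_val x; rewrite !(enum_val_nth i0).
apply: (sorted_ltn_nth _ i0 sA); rewrite ?inE -?cardE //.
by move=> i j k; apply: ltn_trans.
Qed.

Lemma enum_val_le n (A : {set 'I_n}) (x y : 'I_#|A|) :
  (x <= y)%N -> (enum_val x <= enum_val y)%N.
Proof.
by rewrite leq_eqVlt => /orP[/eqP/val_inj->|/enum_val_lt/ltnW].
Qed.

Lemma colex_ge_le (a b : grade) : colex a b -> (b <= a)%O -> b = a.
Proof.
case: a b => [a1 a2] [b1 b2]; rewrite /colex leEprod /=.
by move=> ab ba; congr pair; lia.
Qed.

Section Algorithm.
Variables (m n : nat) (rg : 'I_m -> grade) (cg : 'I_n -> grade).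
Implicit Types (A B C L : 'M['F_2]_(m, n)) (i k r : 'I_m) (c d : 'I_n).

(** A graded change of basis of the source. The inverse [V] is carried along with its grading, since
    it is used as a homomorphism too. *)
Definition col_equiv A B : Prop :=
  exists U V, [/\ graded cg cg U, graded cg cg V, U *m V = 1%:M & B = A *m U].

Lemma col_equiv_refl A : col_equiv A A.
Proof.
have g1 : graded cg cg 1%:M by move=> c d; rewrite mxE; have [->|] := eqVneq c d.
by exists 1%:M, 1%:M; rewrite !mulmx1.
Qed.

Lemma col_equiv_trans A B C : col_equiv A B -> col_equiv B C -> col_equiv A C.
Proof.
move=> [U [V [gU gV UV ->]]] [U' [V' [gU' gV' UV' ->]]].
exists (U *m U'), (V' *m V); split; last exact: esym (mulmxA _ _ _).
- exact: graded_mulmx gU gU'.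
- exact: graded_mulmx gV' gV.
- by rewrite -mulmxA (mulmxA U') UV' mul1mx.
Qed.

Lemma col_equiv_graded A B : graded rg cg A -> col_equiv A B -> graded rg cg B.
Proof. by move=> gA [U [V [gU _ _ ->]]]; apply: graded_mulmx gA gU. Qed.

(** Adding column [d] to [c] is right multiplication by the elementary matrix 1 + E_dc, its own
    inverse in characteristic 2; the condition on grades makes it graded. *)
Lemma add_column_equiv A d c :
  d != c -> (cg d <= cg c)%O -> col_equiv A (add_column A d c).
Proof.
move=> dc le; pose U : 'M['F_2]_n := 1%:M + delta_mx d c.
have gU : graded cg cg U.
  move=> i j; rewrite !mxE; have [->//|ij] := eqVneq i j.
  by rewrite add0r; case: (eqVneq i d) => [->|] //=; case: (eqVneq j c) => [->|].
exists U, U; split=> //.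
  rewrite mulmxDl mul1mx mulmxDr mulmx1 mul_delta_mx_0 1?eq_sym // addr0 -addrA.
  rewrite (_ : _ + delta_mx d c = 0) ?addr0 //.
  by apply/matrixP => i j; rewrite !mxE; case: (_ && _); apply: val_inj.
rewrite mulmxDr mulmx1; apply/matrixP => i j; rewrite !mxE.
rewrite (bigD1 d) //= big1 => [|k kd]; last first.
  by rewrite mxE (negPf kd) mulr0.
rewrite mxE eqxx addr0 /=; have [->|jc] := eqVneq j c; first by rewrite mulr1.
by rewrite mulr0 addr0.
Qed.

(** Columns that share a local pivot have equal grades, so each addition is graded. *)
Lemma phase1_equiv A : col_equiv A (phase1 rg cg A).
Proof.
have step c B : col_equiv B (phase1_step rg cg c B).
  rewrite /phase1_step; case: pickP => [d|_]; last exact: col_equiv_refl.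
  move=> /andP[dc /existsP[i /andP[/andP[_ /eqP ic] /andP[_ /eqP id]]]].
  by apply: add_column_equiv; [rewrite -val_eqE neq_ltn dc | rewrite -ic -id].
rewrite /phase1; elim: (enum 'I_n) A => [|c s IHs] A /=; first exact: col_equiv_refl.
apply: col_equiv_trans (IHs _); rewrite /phase1_column.
apply: iter_invariant (col_equiv_refl _) => B AB.
exact: col_equiv_trans AB (step _ _).
Qed.

Lemma phase1_column_neq A c d i : d != c -> phase1_column rg cg A c i d = A i d.
Proof.
move=> dc; rewrite /phase1_column.
apply: (iter_invariant (Inv := fun B => B i d = A i d)) => // B <-.
rewrite /phase1_step; case: pickP => // d' _.
by rewrite mxE (negPf dc).
Qed.

Lemma eq_local_pivot A B i c :
  (forall k, A k c = B k c) ->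
  is_local_pivot rg cg A i c = is_local_pivot rg cg B i c.
Proof.
move=> AB; rewrite /is_local_pivot /is_pivot AB; congr (_ && _ && _).
by apply: eq_forallb => k; rewrite AB.
Qed.

(** A reducer of a column involves only that column and earlier ones, and these no longer change
    when later columns are treated. *)
Lemma phase1_irreducible A c d : ~~ phase1_reducer rg cg (phase1 rg cg A) c d.
Proof.
suff gen s done B : {in done & s, forall c c', c < c'}%N ->
    pairwise (fun c c' => c < c')%N s ->
    {in done, forall c d, ~~ phase1_reducer rg cg B c d} ->
    let C := foldl (phase1_column rg cg) B s in
    {in done ++ s, forall c d, ~~ phase1_reducer rg cg C c d}.
  apply: (gen (enum 'I_n) [::] A) => //; last by rewrite mem_enum.
  rewrite -sorted_pairwise; last by move=> i j k; apply: ltn_trans.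
  exact: sorted_enum_ord.
elim: s done B => [|c' s IHs] don B dons; first by rewrite cats0.
move=> /= /andP[/allP c's sorts] donB; rewrite -cat_rcons; apply: IHs => //.
  move=> a b; rewrite mem_rcons inE => /orP[/eqP->|/dons ds] bs; first exact: c's.
  by apply: ds; rewrite inE bs orbT.
move=> a; rewrite mem_rcons inE => /orP[/eqP-> d'|da d'].
  exact: phase1_columnP.
have ac' : (a < c')%N by apply: dons => //; rewrite mem_head.
have := donB _ da d'; rewrite /phase1_reducer; apply: contra => /andP[d'a].
rewrite d'a; apply: contraTT => none; apply/existsPn => i.
have := existsPn none i; rewrite !(@eq_local_pivot (phase1_column rg cg B c') B) //.
  by move=> k; apply: phase1_column_neq; rewrite -val_eqE neq_ltn (ltn_trans d'a).
by move=> k; apply: phase1_column_neq; rewrite -val_eqE neq_ltn ac'.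
Qed.

Lemma phase1_pivot_inj A i c d :
  is_local_pivot rg cg (phase1 rg cg A) i c ->
  is_local_pivot rg cg (phase1 rg cg A) i d -> c = d.
Proof.
move=> ic id; apply/eqP; rewrite -val_eqE /=; case: ltngtP => // cd.
  have /negP[] := phase1_irreducible A d c; rewrite /phase1_reducer cd.
  by apply/existsP; exists i; rewrite ic id.
have /negP[] := phase1_irreducible A c d; rewrite /phase1_reducer cd.
by apply/existsP; exists i; rewrite ic id.
Qed.

Hypothesis rg_colex : forall i k, (i <= k)%N -> colex (rg i) (rg k).

(* The rows whose grade is that of column c are the last ones, in co-lexicographic
   order, in which c can be nonzero. *)
Lemma global_no_local_entry L c i :
  graded rg cg L -> ~~ local_negative rg cg L c -> L i c != 0 -> rg i != cg c.
Proof.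
move=> gL + Lic; apply: contra => /eqP ic.
case: (@arg_maxnP _ i (fun k => L k c != 0) val Lic) => k Lkc kmax.
apply/existsP; exists k; rewrite /is_local_pivot /is_pivot Lkc /=.
apply/andP; split; first by apply/forallP => j; apply/implyP; apply: kmax.
by rewrite -ic (colex_ge_le (rg_colex (kmax _ Lic))) // ic; apply: gL.
Qed.

Section Phase2.
Variable L : 'M['F_2]_(m, n).
Hypothesis gL : graded rg cg L.

Local Notation neg := (local_negative rg cg L).
Local Notation pos := (local_positive rg cg L).

(** The second clause keeps the pivots of [L] valid for the columns being added; the third
    eventually makes the image of the output radical. *)
Definition phase2_inv B : Prop :=
  [/\ col_equiv L B, forall i d, neg d -> B i d = L i d &
      forall i c, ~~ neg c -> B i c != 0 -> rg i != cg c].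

Lemma phase2_step_inv B c : ~~ neg c -> phase2_inv B ->
  phase2_inv (phase2_step rg cg L c B).
Proof.
move=> cglob BB; have [LB BL Bloc] := BB.
rewrite /phase2_step; case: pickP => // -[r d] /and4P[/= _ Brc _ lp].
have /andP[_ /eqP rd] := lp.
have dneg : neg d by apply/existsP; exists r.
have gB := col_equiv_graded gL LB.
have dc : d != c by apply: contraNneq cglob => <-.
have le : (cg d <= cg c)%O by rewrite -rd; apply: gB.
split.
- by apply: col_equiv_trans LB _; apply: add_column_equiv.
- move=> i e eneg; rewrite mxE; have [ec|_] := eqVneq e c; last exact: BL.
  by rewrite -ec eneg in cglob.
- move=> i e eglob; rewrite mxE; have [->|_] := eqVneq e c; last exact: Bloc.
  have [->|Bic _] := eqVneq (B i c) 0; last exact: Bloc.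
  (* A new entry in a row of grade [cg c] would give [cg c <= cg d <= cg c], so the entry in row [r]
     would already break the invariant. *)
  rewrite add0r => /gB id; have := Bloc r c cglob Brc; apply: contra => /eqP ic.
  by rewrite rd eq_le le -ic id.
Qed.

Lemma phase2_column_inv B c : ~~ neg c -> phase2_inv B ->
  phase2_inv (phase2_column rg cg L B c).
Proof.
by move=> cglob; apply: iter_invariant => C; apply: phase2_step_inv.
Qed.

Lemma phase2_column_neq B c d i : d != c -> phase2_column rg cg L B c i d = B i d.
Proof.
move=> dc; rewrite /phase2_column.
apply: (iter_invariant (Inv := fun C => C i d = B i d)) => // C <-.
rewrite /phase2_step; case: pickP => // rd _.
by rewrite mxE (negPf dc).
Qed.

(** Otherwise the last nonzero local positive row, with its pivot column, would still be a
    reducer. *)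
Lemma phase2_column_cleared B c i : ~~ neg c -> phase2_inv B -> pos i ->
  phase2_column rg cg L B c i c = 0.
Proof.
move=> cglob [_ BL _] posi; set C := phase2_column _ _ _ _ _.
apply/eqP/contraT => Cic.
have Pi : pos i && (C i c != 0) by rewrite posi.
case: (@arg_maxnP _ i (fun k => pos k && (C k c != 0)) val Pi) => k.
move=> /andP[kpos Ckc] kmax.
have /existsP[d kd] := kpos.
have /negP[] := phase2_columnP (k, d) cglob BL.
rewrite /phase2_reducer /= kpos Ckc kd andbT.
by apply/forallP => j; apply/implyP; apply: kmax.
Qed.

Lemma phase2P : phase2_inv (phase2 rg cg L) /\
  forall i c, ~~ neg c -> pos i -> phase2 rg cg L i c = 0.
Proof.
(* The middle clause says that later passes leave a cleared column alone. *)
suff gen s B : uniq s -> all (fun c => ~~ neg c) s -> phase2_inv B ->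
    let C := foldl (phase2_column rg cg L) B s in
    [/\ phase2_inv C, forall i c, c \notin s -> C i c = B i c &
        forall i c, c \in s -> pos i -> C i c = 0].
  have [|||inv _ clr] := gen [seq c <- enum 'I_n | ~~ neg c] L.
  - by rewrite filter_uniq ?enum_uniq.
  - exact: filter_all.
  - split; [exact: col_equiv_refl | by [] | move=> i c; exact: global_no_local_entry].
  by split=> // i c cglob; apply: clr; rewrite mem_filter cglob mem_enum.
elim: s B => [|c s IHs] B /=; first by split.
move=> /andP[cs us] /andP[cglob sglob] BB.
have [inv nots clr] := IHs _ us sglob (phase2_column_inv cglob BB).
split=> // i d; rewrite inE.
  by rewrite negb_or => /andP[dc ds]; rewrite nots // phase2_column_neq.
have [-> _ posi|_ ds] := eqVneq d c; last exact: clr.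
by rewrite nots // phase2_column_cleared.
Qed.

End Phase2.
End Algorithm.

(** * Inclusion of a subset of a basis, as a matrix *)

Section Inclusion.
Variables (n : nat) (S : {set 'I_n}).

(** Multiplying by it on the left extends by zero outside [S]; its transpose restricts to [S]. *)
Definition incl_mx : 'M['F_2]_(n, #|S|) := colsub enum_val 1%:M.

Lemma mulmx_incl m (A : 'M['F_2]_(m, n)) : A *m incl_mx = colsub enum_val A.
Proof. by rewrite mulmx_colsub mulmx1. Qed.

Lemma tr_incl_mulmx m (A : 'M['F_2]_(n, m)) : incl_mx^T *m A = rowsub enum_val A.
Proof. by rewrite /incl_mx trmx_mxsub trmx1 mul_rowsub_mx mul1mx. Qed.

Lemma tr_incl_incl : incl_mx^T *m incl_mx = 1%:M.
Proof.
rewrite tr_incl_mulmx; apply/matrixP => i j; rewrite !mxE.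
by rewrite (inj_eq enum_val_inj).
Qed.

Lemma incl_rowsub m (A : 'M['F_2]_(n, m)) :
  (forall i j, i \notin S -> A i j = 0) -> incl_mx *m rowsub enum_val A = A.
Proof.
move=> A0; apply/matrixP => i j; rewrite !mxE.
have [iS|iS] := boolP (i \in S); last first.
  rewrite A0 // big1 // => k _; rewrite !mxE.
  have [ik|_] := eqVneq i (enum_val k); last exact: mul0r.
  by rewrite ik enum_valP in iS.
rewrite (bigD1 (enum_rank_in iS i)) //= !mxE enum_rankK_in // eqxx mul1r.
rewrite big1 ?addr0 // => k ki; rewrite !mxE.
have [ik|_] := eqVneq i (enum_val k); last exact: mul0r.
by case/eqP: ki; apply: enum_val_inj; rewrite enum_rankK_in // -ik.
Qed.

Variable u : 'I_n -> grade.

Lemma graded_incl : graded u (u \o enum_val) incl_mx.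
Proof. by move=> i k; rewrite !mxE /=; have [->|] := eqVneq i (enum_val k). Qed.

Lemma graded_tr_incl : graded (u \o enum_val) u incl_mx^T.
Proof. by move=> k i; rewrite !mxE /=; have [->|] := eqVneq i (enum_val k). Qed.

End Inclusion.

(** * The triangular block of local positive rows and local negative columns *)

Section Triangular.
Variables (m n : nat) (rg : 'I_m -> grade) (cg : 'I_n -> grade).
Variables L M : 'M['F_2]_(m, n).
Local Notation neg := (local_negative rg cg L).
Local Notation pos := (local_positive rg cg L).
Hypothesis gL : graded rg cg L.
Hypothesis pivot_inj : forall i c d,
  is_local_pivot rg cg L i c -> is_local_pivot rg cg L i d -> c = d.
Hypothesis negM : forall i c, neg c -> M i c = L i c.

(** Take the largest row [k] that is the local pivot of some column [d] with [w d] nonzero. Any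
    other local column of the support with an entry in row [k] would have its pivot at [k] as well,
    so row [k] of [M *m w] is nonzero. *)
Lemma local_block_injective (w : 'cV_n) :
  (forall i c, ~~ neg c -> pos i -> M i c = 0) ->
  (forall i, pos i -> (M *m w) i 0 = 0) -> forall c, neg c -> w c 0 = 0.
Proof.
move=> glob0 Mw c /existsP[i ic]; apply/eqP/contraT => wc.
pose W k := [exists d, is_local_pivot rg cg L k d && (w d 0 != 0)].
have Wi : W i by apply/existsP; exists c; rewrite ic.
case: (@arg_maxnP _ i W val Wi) => k /existsP[d /andP[kd wd]] kmax.
have kpos : pos k by apply/existsP; exists d.
have := Mw k kpos; rewrite mxE (bigD1 d) //= big1 ?addr0 => [/eqP|e ed].
  rewrite mulf_eq0 (negPf wd) orbF negM; last by apply/existsP; exists k.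
  by have /andP[/andP[/negPf->]] := kd.
have [eneg|eglob] := boolP (neg e); last by rewrite glob0 ?mul0r.
rewrite negM //; have [->|we] := eqVneq (w e 0) 0; first exact: mulr0.
have [->|Lke] := eqVneq (L k e) 0; first exact: mul0r.
have /existsP[j je] := eneg; have /andP[/andP[_ /forallP/(_ k)]] := je.
rewrite Lke /= => kj _.
have jk : (j <= k)%N by apply: kmax; apply/existsP; exists e; rewrite je.
have jkE : j = k by apply: val_inj; apply/eqP; rewrite eqn_leq jk kj.
by rewrite (pivot_inj kd (d := e)) ?eqxx // -jkE in ed.
Qed.

(** Gaussian elimination from the last row upwards: a nonzero entry in a local positive row is
    cleared by the column with that pivot, whose grade equals that of the row and so is at most
    [z]. *)
Lemma local_block_surjective z (x : 'cV_m) :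
  (forall i, x i 0 != 0 -> (rg i <= z)%O) ->
  exists (y : 'cV_m) (w : 'cV_n),
    [/\ x = y + M *m w, forall c, w c 0 != 0 -> (cg c <= z)%O &
    forall i, pos i -> y i 0 = 0].
Proof.
(* [N] bounds the local positive rows still to be cleared. *)
suff gen N (x' : 'cV_m) : (forall i, x' i 0 != 0 -> (rg i <= z)%O) ->
    (forall i, pos i -> x' i 0 != 0 -> (i < N)%N) ->
    exists (y : 'cV_m) (w : 'cV_n),
      [/\ x' = y + M *m w, forall c, w c 0 != 0 -> (cg c <= z)%O &
      forall i, pos i -> y i 0 = 0].
  by move=> xz; apply: (gen m x).
elim: N x' => [|N IHN] x' xz xN.
  exists x', 0; split=> [|c|i posi]; first by rewrite mulmx0 addr0.
    by rewrite mxE eqxx.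
  by apply/eqP/contraT => /(xN i posi).
have [/existsP[r /and3P[posr xr /eqP rN]]|/existsPn none] :=
  boolP [exists r : 'I_m, [&& pos r, x' r 0 != 0 & r == N :> nat]]; last first.
  apply: IHN => // i posi xi; rewrite ltn_neqAle -ltnS xN // andbT.
  by have := none i; rewrite posi xi.
have /existsP[c rc] := posr; have cneg : neg c by apply/existsP; exists r.
have /andP[/andP[Lrc /forallP Lmax] /eqP rgc] := rc.
have cz : (cg c <= z)%O by rewrite -rgc; apply: xz.
pose e : 'cV['F_2]_n := delta_mx c 0.
have Me i : (M *m e) i 0 = L i c by rewrite -colE mxE negM.
have [||y [w [xE wz y0]]] := IHN (x' + M *m e).
- move=> i; rewrite mxE Me.
  have [->|/xz //] := eqVneq (x' i 0) 0; rewrite add0r => /gL ic.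
  exact: le_trans ic cz.
- move=> i posi; rewrite mxE Me => xi.
  have ir : i != r by apply: contraNneq xi => ->; rewrite F2_add_nz.
  rewrite ltn_neqAle -{1}rN ir /=.
  have [x0|/(xN i posi)//] := eqVneq (x' i 0) 0; rewrite x0 add0r in xi.
  by rewrite -rN; apply: (implyP (Lmax i)).
exists y, (w - e); split=> //.
  by rewrite mulmxBr addrA -xE addrK.
move=> d; rewrite !mxE andbT; have [->//|_] := eqVneq d c.
by rewrite subr0; apply: wz.
Qed.
End Triangular.

(** * Minimality of the output *)

Section ImageToKernel.
Variables (F1 F0 : pmod) (p : phom F1 F0).

Lemma image_ker_proof z (x : F1 z) : p z x \in ker_pred (coker_proj p z).
Proof.
rewrite /in_mem /= /ker_pred -(linear0 (coker_proj p z)); apply/eqP/lcoker_piP.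
by exists x; rewrite subr0.
Qed.
Definition image_ker_fun z (x : F1 z) : pker (coker_proj p) z :=
  LKer (image_ker_proof x).
Lemma image_ker_linear z : linear (@image_ker_fun z).
Proof. by move=> c x y; apply: val_inj; rewrite /= !linearP. Qed.
HB.instance Definition _ z :=
  GRing.isLinear.Build 'F_2 (F1 z) (pker (coker_proj p) z) _ (@image_ker_fun z)
    (@image_ker_linear z).
Lemma image_ker_nat (a b : grade) (ab : (a <= b)%O) (x : F1 a) :
  (@image_ker_fun b : {linear F1 b -> pker (coker_proj p) b}) (pmap F1 ab x) =
  pmap (pker (coker_proj p)) ab
    ((@image_ker_fun a : {linear F1 a -> pker (coker_proj p) a}) x).
Proof. by apply: val_inj; rewrite /= pnat. Qed.
(** The corestriction of [p]; it is onto because the kernel of the projection is Im [p]. *)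
Definition image_ker : phom F1 (pker (coker_proj p)) :=
  @PHom _ _ (fun z => @image_ker_fun z) image_ker_nat.

Lemma image_ker_surj z y : exists x, image_ker z x = y.
Proof.
have /eqP := valP y; rewrite -(linear0 (coker_proj p z)) => /lcoker_piP[x].
by rewrite subr0 => px; exists x; apply: val_inj.
Qed.

Lemma image_ker_eq0 z x : image_ker z x = 0 -> p z x = 0.
Proof. by move=> /(congr1 val). Qed.

Lemma homog_map_image_ker_inj v w :
  homog_map p v = homog_map p w -> homog_map image_ker v = homog_map image_ker w.
Proof.
case: v w => [z x] [z' y] pxy; have /= zz' := congr1 (@projT1 _ _) pxy; subst z'.
by congr existT; apply: val_inj; apply: homog_inj pxy.
Qed.
End ImageToKernel.

(** Both the projection to the cokernel and [image_ker] are surjections with radical kernel, so the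
    standard bases map bijectively to minimal generating sets. *)
Lemma minimal_gmatrix (Q : gmatrix) :
  (forall i j, entries Q i j != 0 -> row_grade i != col_grade j) ->
  (forall z x, hom_of_gmatrix Q z x = 0 -> rad x) ->
  minimal (hom_of_gmatrix Q).
Proof.
move=> Qloc Qker; set p := hom_of_gmatrix Q.
pose B0 := @std_basis _ (@row_grade Q); pose B1 := @std_basis _ (@col_grade Q).
have bB0 : basis B0 := std_basis_basis _; have bB1 : basis B1 := std_basis_basis _.
have bF0 := @free_on_bounded_below _ (@row_grade Q).
have bF1 := @free_on_bounded_below _ (@col_grade Q).
(* A nonzero contribution to a row of grade [z] needs a column of grade both at least and at most
   [z], which [Qloc] forbids. *)
have im_rad z y : coker_proj p z y = 0 -> rad y.
  rewrite -(linear0 (coker_proj p z)) => /lcoker_piP[x]; rewrite subr0 => <-.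
  apply: rad_coords => i iz; rewrite coords_hom_of_gmatrix mxE big1 // => j _.
  have [->|Qij] := eqVneq (entries Q i j) 0; first exact: mul0r.
  have [->|/coords_supp xj] := eqVneq (coords x j 0) 0; first exact: mulr0.
  have /negP[] := Qloc i j Qij; rewrite eq_le (entries_homogeneous Qij) /=.
  by rewrite iz.
split.
  exists B0, (homog_map (coker_proj p) @` B0)%classic.
  have surj z (y : pcoker p z) : exists x, coker_proj p z x = y.
    by exists (lcoker_repr y); apply: lcoker_reprK.
  split=> //; first exact: (minimal_generators_image bF0 surj im_rad bB0.2).
  split=> [x Bx||//]; first by exists x.
  exact: (minimal_generators_inj bF0 im_rad bB0.2).
exists B1, (homog_map (image_ker p) @` B1)%classic.
have ker_rad z x : image_ker p z x = 0 -> rad x by move/image_ker_eq0/Qker.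
split=> //.
  exact: (minimal_generators_image bF1 (@image_ker_surj _ _ p) ker_rad bB1.2).
split.
- by move=> v Bv; exists (homog_map (image_ker p) v) => //; exists v.
- move=> v w Bv Bw /homog_map_image_ker_inj.
  exact: (minimal_generators_inj bF1 ker_rad bB1.2).
- by move=> _ [_ [v Bv <-] <-]; exists v.
Qed.

(** * Comparison of the output with the input matrix *)

Section MultiChunkOutput.
Variable P : gmatrix.
Let A := entries P.
Let rg := @row_grade P.
Let cg := @col_grade P.
Let L := phase1 rg cg A.
Let M := phase2 rg cg L.
Let Rows := [set i | ~~ local_positive rg cg L i].
Let Cols := [set c | ~~ local_negative rg cg L c].
Let J0 := incl_mx Rows.
Let J1 := incl_mx Cols.

Let gA : graded rg cg A. Proof. exact: entries_homogeneous. Qed.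
Let gL : graded rg cg L.
Proof. exact: col_equiv_graded gA (phase1_equiv rg cg A). Qed.
Let MP : phase2_inv rg cg L M /\
  forall i c, ~~ local_negative rg cg L c -> local_positive rg cg L i -> M i c = 0.
Proof. exact: (phase2P (@rows_colex P) gL). Qed.
Let gM : graded rg cg M. Proof. by have [[/(col_equiv_graded gL)]] := MP. Qed.

Lemma multi_chunk_homogeneous i j : entries (multi_chunk P) i j != 0 ->
  (@row_grade (multi_chunk P) i <= @col_grade (multi_chunk P) j)%O.
Proof. by rewrite mxE; apply: gM. Qed.

Lemma multi_chunk_rows_colex (i j : 'I_(nrows (multi_chunk P))) : (i <= j)%N ->
  colex (@row_grade (multi_chunk P) i) (@row_grade (multi_chunk P) j).
Proof. by move=> ij; apply: rows_colex; apply: enum_val_le. Qed.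

Lemma multi_chunk_cols_colex (i j : 'I_(ncols (multi_chunk P))) : (i <= j)%N ->
  colex (@col_grade (multi_chunk P) i) (@col_grade (multi_chunk P) j).
Proof. by move=> ij; apply: cols_colex; apply: enum_val_le. Qed.

Definition multi_chunk_gmatrix : gmatrix := GMatrix
  multi_chunk_homogeneous multi_chunk_rows_colex multi_chunk_cols_colex.
Let Q := multi_chunk_gmatrix.

Lemma multi_chunk_no_local_entries i j :
  entries Q i j != 0 -> @row_grade Q i != @col_grade Q j.
Proof.
rewrite mxE; have [[_ _ Mloc] _] := MP; apply: Mloc.
by have := enum_valP j; rewrite inE.
Qed.

(** The rows removed in phase III are zero in every global column. *)
Let MJ1 : M *m J1 = J0 *m entries Q.
Proof.
have -> : entries Q = rowsub enum_val (M *m J1).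
  by rewrite mulmx_incl; apply/matrixP => i j; rewrite !mxE.
rewrite incl_rowsub // => i j; rewrite inE negbK => posi.
rewrite mulmx_incl mxE; have [_ M0] := MP; apply: M0 => //.
by have := enum_valP j; rewrite inE.
Qed.

Let AM : col_equiv cg A M.
Proof.
by have [[LM _ _] _] := MP; apply: col_equiv_trans LM; apply: phase1_equiv.
Qed.

(** With [M = A *m U], take [phi] as [U *m J1] and [psi] as [J1^T *m V]. The second property lets
    [phi] embed Ker [Q] into Ker [P]. *)
Lemma multi_chunk_retract :
  exists (phi : phom (free_on (@col_grade Q)) (free_on cg))
         (psi : phom (free_on cg) (free_on (@col_grade Q))),
    (forall z x, psi z (phi z x) = x) /\
    (forall z x, coords (hom_of_gmatrix P z (phi z x)) =
       J0 *m coords (hom_of_gmatrix Q z x)).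
Proof.
have [U [V [gU gV UV MU]]] := AM.
exists (mxhom (graded_mulmx gU (graded_incl (S := Cols) cg))).
exists (mxhom (graded_mulmx (graded_tr_incl (S := Cols) cg) gV)).
split=> z x.
  apply: coords_inj; rewrite !coords_mxhom !mulmxA -(mulmxA _ V) (mulmx1C UV).
  by rewrite mulmx1 tr_incl_incl mul1mx.
by rewrite !coords_hom_of_gmatrix coords_mxhom !mulmxA -MU MJ1.
Qed.

Lemma multi_chunk_coker :
  isomorphic (pcoker (hom_of_gmatrix Q)) (pcoker (hom_of_gmatrix P)).
Proof.
have [phi [_ [_ phiE]]] := multi_chunk_retract.
have [U [V [gU gV UV MU]]] := AM.
have [[_ negM _] M0] := MP.
have pinj := @phase1_pivot_inj _ _ rg cg A.
pose h := mxhom (graded_incl (S := Rows) rg).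
apply: (@pcoker_isomorphic _ _ _ _ _ _ h) => [z x|z y t hy|z x].
- by exists (phi z x); apply: coords_inj; rewrite coords_mxhom phiE.
(* Injectivity: [V *m coords t] expresses [t] in the new basis. Its image under [M] vanishes on the
   local positive rows, so it is supported on the global columns, and [s] is its restriction to
   them. *)
- pose s := mxhom (graded_mulmx (graded_tr_incl (S := Cols) cg) gV) z t.
  have MV : M *m (V *m coords t) = J0 *m coords y.
    rewrite mulmxA MU -(mulmxA A) UV mulmx1 -coords_hom_of_gmatrix -hy.
    by rewrite coords_mxhom.
  have w0 : forall c, local_negative rg cg L c -> (V *m coords t) c 0 = 0.
    apply: (local_block_injective pinj negM M0) => i posi; rewrite MV mxE.
    rewrite big1 // => k _; rewrite !mxE.
    have [ik|_] := eqVneq i (enum_val k); last exact: mul0r.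
    by have := enum_valP k; rewrite -ik inE posi.
  exists s; apply: (@coords_inj _ (@row_grade Q)).
  rewrite coords_hom_of_gmatrix coords_mxhom.
  rewrite -[entries Q]mul1mx -(tr_incl_incl Rows) -(mulmxA _ J0) -MJ1 -!mulmxA.
  rewrite (tr_incl_mulmx Cols) incl_rowsub; last first.
    by move=> i j; rewrite inE negbK ord1; apply: w0.
  by rewrite MV mulmxA tr_incl_incl mul1mx.
(* Surjectivity: modulo the image of [M], which is that of [P], [x] can be moved off the local
   positive rows and into the image of [h]. *)
have [y [w [xE wz y0]]] := local_block_surjective gL negM (@coords_supp _ _ _ x).
have yz i : y i 0 != 0 -> (rg i <= z)%O.
  have -> : y = coords x - M *m w by rewrite xE addrK.
  rewrite mxE [X in _ + X]mxE; have [->|/coords_supp//] := eqVneq (coords x i 0) 0.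
  by rewrite sub0r oppr_eq0; apply: graded_mulmx_supp gM wz _.
have yE : coords (of_coords (rg \o enum_val) z (rowsub (@enum_val _ (mem Rows)) y)) =
    rowsub enum_val y.
  by apply: of_coordsK => i; rewrite mxE; apply: yz.
have wE := of_coordsK (graded_mulmx_supp gU wz).
exists (of_coords _ z (rowsub enum_val y)), (of_coords cg z (U *m w)).
apply: coords_inj; rewrite coordsD coords_mxhom coords_hom_of_gmatrix yE wE.
rewrite incl_rowsub ?mulmxA -?MU // => i j; rewrite inE negbK ord1.
exact: y0.
Qed.

End MultiChunkOutput.

Theorem proposition4p3 (W : pmod) (P : gmatrix) :
  semi_minimal_presentation (hom_of_gmatrix P) W ->
  exists Q : gmatrix,
    amatrix Q = multi_chunk P /\ minimal_presentation (hom_of_gmatrix Q) W.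
Proof.
move=> Psm; have [[_ _ PW] _] := Psm.
exists (multi_chunk_gmatrix P); split=> //; split.
  split; [exact: free_on_is_free | exact: free_on_is_free |].
  exact: isomorphic_trans (multi_chunk_coker P) PW.
apply: minimal_gmatrix => [i j|z x Qx]; first exact: multi_chunk_no_local_entries.
(* [phi] sends [x] to a radical element of Ker [P], and [psi] brings it back while preserving the
   radical. *)
have [phi [psi [phiK phiE]]] := multi_chunk_retract P.
rewrite -(phiK z x); apply: rad_hom; apply: (semi_minimal_ker_rad Psm).
by apply: coords_inj; rewrite phiE Qx !linear0.
Qed.
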